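(* Let $U\subset\mathbb R^n$ be open, $X$ a $C^1$ vector field on $U$, $f=(f_0,f_1,\dots,f_\ell):U\to\mathbb R^{r+\ell}$ a $C^2$ map, $x_0\in U$, $K$ a constant symmetric positive definite $(r+\ell)\times(r+\ell)$ matrix, and $V(x)=\tfrac12(f(x)-f(x_0))^TK(f(x)-f(x_0))$. Assume $\nabla V(x)\cdot X(x)=0$ for all $x\in U$, $V^{-1}(0)$ is compact, and $Df(x)$ is onto for all $x\in V^{-1}(0)$. Then there is a number $c>0$ (and, if necessary, an open neighborhood $W\subset U$ of $V^{-1}(0)$ to which the system is restricted) such that every trajectory of $\dot x = X(x)-\nabla V(x)$ starting in $V^{-1}([0,c])$ remains in $V^{-1}([0,c])$ for all $t\ge0$ and converges to $V^{-1}(0)$ as $t\to\infty$. *)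

(* Defs.v *)
From Stdlib Require Import Reals List.
Open Scope R_scope.

(* A point of R^n is represented by its coordinate function nat -> R;
   only the coordinates with index < n are ever looked at (norms, sums,
   matrix products all range over indices < n). *)
Definition vec := nat -> R.
Definition mat := nat -> nat -> R.   (* A i j = entry in row i, column j *)
Definition vset := vec -> Prop.

Fixpoint rsum (n : nat) (g : nat -> R) : R :=
  match n with O => 0 | S k => rsum k g + g k end.

Definition dot (n : nat) (u v : vec) : R := rsum n (fun i => u i * v i).
Definition norm (n : nat) (v : vec) : R := sqrt (dot n v v).
Definition vadd (u v : vec) : vec := fun i => u i + v i.
Definition vsub (u v : vec) : vec := fun i => u i - v i.
Definition vscal (a : R) (v : vec) : vec := fun i => a * v i.
Definition mulmv (n : nat) (A : mat) (v : vec) : vec :=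
  fun i => rsum n (fun j => A i j * v j).

Definition is_open (n : nat) (U : vset) : Prop :=
  forall x, U x -> exists d, 0 < d /\ forall y, norm n (vsub y x) < d -> U y.

Definition is_compact (n : nat) (Z : vset) : Prop :=
  forall (I : Type) (O : I -> vset),
    (forall i, is_open n (O i)) ->
    (forall x, Z x -> exists i, O i x) ->
    exists l : list I, forall x, Z x -> exists i, In i l /\ O i x.

Definition has_deriv_at (n m : nat) (g : vec -> vec) (x : vec) (J : mat) : Prop :=
  forall eps, 0 < eps -> exists d, 0 < d /\
    forall h, norm n h < d ->
      norm m (vsub (vsub (g (vadd x h)) (g x)) (mulmv n J h)) <= eps * norm n h.

Definition continuous_on (n : nat) (U : vset) (F : vec -> R) : Prop :=
  forall x, U x -> forall eps, 0 < eps -> exists d, 0 < d /\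
    forall y, U y -> norm n (vsub y x) < d -> Rabs (F y - F x) < eps.

Definition C1_on (n m : nat) (U : vset) (g : vec -> vec) : Prop :=
  exists Dg : vec -> mat,
    (forall x, U x -> has_deriv_at n m g x (Dg x)) /\
    (forall i j, (i < m)%nat -> (j < n)%nat -> continuous_on n U (fun x => Dg x i j)).

Definition is_gradient (n : nat) (V : vec -> R) (x : vec) (gv : vec) : Prop :=
  has_deriv_at n 1 (fun y => fun _ => V y) x (fun _ j => gv j).

Definition onto (n m : nat) (A : mat) : Prop :=
  forall w : vec, exists v : vec, forall i, (i < m)%nat -> mulmv n A v i = w i.

Definition symmetric (m : nat) (K : mat) : Prop :=
  forall i j, (i < m)%nat -> (j < m)%nat -> K i j = K j i.

Definition posdef (m : nat) (K : mat) : Prop :=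
  forall v : vec, (exists i, (i < m)%nat /\ v i <> 0) -> 0 < dot m v (mulmv m K v).

Definition Lyap (m : nat) (K : mat) (f : vec -> vec) (x0 : vec) (x : vec) : R :=
  / 2 * dot m (vsub (f x) (f x0)) (mulmv m K (vsub (f x) (f x0))).

(* y is a solution of x' = F x on the interval I (derivative taken within I,
   so one-sided at endpoints), staying in the domain W *)
Definition is_sol (n : nat) (F : vec -> vec) (W : vset) (I : R -> Prop) (y : R -> vec) : Prop :=
  forall t, I t -> W (y t) /\
    forall eps, 0 < eps -> exists d, 0 < d /\
      forall s, I s -> Rabs (s - t) < d ->
        norm n (vsub (vsub (y s) (y t)) (vscal (s - t) (F (y t)))) <= eps * Rabs (s - t).

Definition conv_to_set (n : nat) (Z : vset) (y : R -> vec) : Prop :=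
  forall eps, 0 < eps -> exists T, forall t, T <= t ->
    exists z, Z z /\ norm n (vsub (y t) z) < eps.

(* Main.v *)
(** The vector field [X] is tangent to the level sets of [V], so along solutions
    [d/dt V = - |grad V|^2]. Since [grad V = Df^T K (f - f x0)] and [Df] is onto along the compact
    zero set [Z] of [V], there are a neighbourhood [W = {x | dist (x, Z) < r}] and a constant [C]
    with [V <= C |grad V|] on [W]. By compactness, small values of [V] on [W] force closeness to
    [Z], so a sublevel set of [V] in [W] stays at distance at least [r/2] from the boundary of
    [W]: solutions cannot leave it, exist for all times because the field is bounded and Lipschitz
    on [W], and [V] decreases to [0] along them. Existence comes from Picard iteration for a
    bounded globally Lipschitz extension of the field. *)

From Stdlib Require Import Reals List Lra Lia ClassicalEpsilon FunctionalExtensionality.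
From Coquelicot Require Import Coquelicot.
(* Coquelicot also defines [norm] and [continuous_on]; importing [Defs] last gives its versions
   precedence. *)
Require Import Defs.
Open Scope R_scope.

(** * Euclidean norm on the first [n] coordinates *)

(** Two obstacles shape the proof: [gV] is given only by the property of being a gradient, and [W]
    need not be convex or closed. An explicit formula for [gV], read off from derivatives along
    lines, makes the field locally Lipschitz. Nonconvexity is met by a Lipschitz bound at a fixed
    scale combined with a sup bound; nonclosedness by a margin, since all points within [/ C] of [W]
    still lie in [U]. Every local estimate carries a single constant [C] and weakens as [C] grows,
    radii entering as [/ C], so that one finite subcover makes all of them uniform.

    A bound of [V] that is linear in the length of the gradient suffices because no rate is claimed:
    while [V] exceeds [delta] it decreases at speed at least [(delta / C)^2], which cannot last
    since [V] is nonnegative.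

    Maximal solutions do not appear: the extended field has a flow for all [t >= 0], and confinement
    to [W] is propagated in time steps of fixed length. Vectors also carry coordinates of index [n]
    and above, so solutions are unique only on the first [n] coordinates and have to be glued. *)

Lemma rsum_ext (n : nat) (g h : nat -> R) :
  (forall i, (i < n)%nat -> g i = h i) -> rsum n g = rsum n h.
Proof.
  induction n as [|n IH]; intros H; simpl; [reflexivity|].
  rewrite IH, H by (intros; try apply H; lia). reflexivity.
Qed.

Lemma rsum_plus (n : nat) (g h : nat -> R) :
  rsum n (fun i => g i + h i) = rsum n g + rsum n h.
Proof. induction n as [|n IH]; simpl; [lra|rewrite IH; lra]. Qed.

Lemma rsum_minus (n : nat) (g h : nat -> R) :
  rsum n (fun i => g i - h i) = rsum n g - rsum n h.
Proof. induction n as [|n IH]; simpl; [lra|rewrite IH; lra]. Qed.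

Lemma rsum_scal (n : nat) (a : R) (g : nat -> R) :
  rsum n (fun i => a * g i) = a * rsum n g.
Proof. induction n as [|n IH]; simpl; [lra|rewrite IH; lra]. Qed.

Lemma rsum_const (n : nat) (a : R) : rsum n (fun _ => a) = INR n * a.
Proof. induction n as [|n IH]; [simpl; lra|rewrite S_INR; simpl; rewrite IH; lra]. Qed.

Lemma rsum_le (n : nat) (g h : nat -> R) :
  (forall i, (i < n)%nat -> g i <= h i) -> rsum n g <= rsum n h.
Proof.
  induction n as [|n IH]; intros H; simpl; [lra|].
  apply Rplus_le_compat; [apply IH; intros; apply H; lia | apply H; lia].
Qed.

Lemma rsum_nonneg (n : nat) (g : nat -> R) :
  (forall i, (i < n)%nat -> 0 <= g i) -> 0 <= rsum n g.
Proof.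
  intros H. replace 0 with (rsum n (fun _ => 0)) by (rewrite rsum_const; ring).
  now apply rsum_le.
Qed.

Lemma rsum_term_le (n : nat) (g : nat -> R) (i : nat) :
  (forall j, (j < n)%nat -> 0 <= g j) -> (i < n)%nat -> g i <= rsum n g.
Proof.
  induction n as [|n IH]; intros H Hi; [lia|]. simpl.
  destruct (Nat.eq_dec i n) as [->|Hn].
  - assert (0 <= rsum n g) by (apply rsum_nonneg; intros; apply H; lia). lra.
  - assert (g i <= rsum n g) by (apply IH; [intros; apply H|]; lia).
    assert (0 <= g n) by (apply H; lia). lra.
Qed.

Lemma rsum_Rabs (n : nat) (g : nat -> R) :
  Rabs (rsum n g) <= rsum n (fun i => Rabs (g i)).
Proof.
  induction n as [|n IH]; simpl; [rewrite Rabs_R0; lra|].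
  eapply Rle_trans; [apply Rabs_triang|lra].
Qed.

Lemma rsum_swap (n m : nat) (g : nat -> nat -> R) :
  rsum n (fun i => rsum m (g i)) = rsum m (fun j => rsum n (fun i => g i j)).
Proof.
  induction n as [|n IH]; simpl.
  - rewrite rsum_const; ring.
  - rewrite IH, <- rsum_plus. reflexivity.
Qed.

Lemma rsum_delta (n i : nat) (w : nat -> R) : (i < n)%nat ->
  rsum n (fun k => w k * (if Nat.eq_dec k i then 1 else 0)) = w i.
Proof.
  induction n as [|n IH]; intros Hi; [lia|]. simpl.
  destruct (Nat.eq_dec n i) as [->|Hn].
  - rewrite (rsum_ext i _ (fun _ => 0)).
    + rewrite rsum_const; ring.
    + intros k Hk. destruct (Nat.eq_dec k i); [lia|ring].
  - rewrite IH by lia. ring.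
Qed.

Lemma dot_nonneg (n : nat) (v : vec) : 0 <= dot n v v.
Proof. apply rsum_nonneg; intros; nra. Qed.

Lemma norm_nonneg (n : nat) (v : vec) : 0 <= norm n v.
Proof. apply sqrt_pos. Qed.

Lemma norm_sqr (n : nat) (v : vec) : norm n v * norm n v = dot n v v.
Proof. apply sqrt_sqrt, dot_nonneg. Qed.

Lemma norm_ext (n : nat) (u v : vec) :
  (forall i, (i < n)%nat -> u i = v i) -> norm n u = norm n v.
Proof.
  intros H. unfold norm, dot. f_equal. apply rsum_ext.
  intros i Hi. now rewrite H.
Qed.

(** Cauchy-Schwarz by induction on the dimension. With [a], [b] the norms of the first [n]
    coordinates and [s], [t] the last ones, the step is [(a b + |s t|)^2 <= (a^2 + s^2) (b^2 +
    t^2)], whose defect is the square of [a |t| - b |s|]. *)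
Lemma dot_le_norm (n : nat) (u v : vec) : Rabs (dot n u v) <= norm n u * norm n v.
Proof.
  induction n as [|n IH].
  - unfold dot at 1; simpl. rewrite Rabs_R0.
    apply Rmult_le_pos; apply norm_nonneg.
  - assert (Hu := norm_sqr n u). assert (Hv := norm_sqr n v).
    assert (Hu' := norm_sqr (S n) u). assert (Hv' := norm_sqr (S n) v).
    assert (Pu := norm_nonneg n u). assert (Pv := norm_nonneg n v).
    assert (Pu' := norm_nonneg (S n) u). assert (Pv' := norm_nonneg (S n) v).
    change (dot (S n) u u) with (dot n u u + u n * u n) in Hu'.
    change (dot (S n) v v) with (dot n v v + v n * v n) in Hv'.
    change (dot (S n) u v) with (dot n u v + u n * v n).
    rewrite <- Hu in Hu'. rewrite <- Hv in Hv'.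
    apply Rabs_le_between in IH.
    set (a := norm n u) in *. set (b := norm n v) in *.
    set (a' := norm (S n) u) in *. set (b' := norm (S n) v) in *.
    set (s := u n) in *. set (t := v n) in *.
    assert (H : Rabs (a * b + Rabs (s * t)) <= Rabs (a' * b')).
    { apply Rsqr_le_abs_0. unfold Rsqr.
      replace (a' * b' * (a' * b')) with ((a' * a') * (b' * b')) by ring.
      rewrite Hu', Hv'. rewrite Rabs_mult.
      assert (Es : s * s = Rabs s * Rabs s) by (rewrite <- Rabs_mult, Rabs_pos_eq; nra).
      assert (Et : t * t = Rabs t * Rabs t) by (rewrite <- Rabs_mult, Rabs_pos_eq; nra).
      rewrite Es, Et. generalize (Rabs s) (Rabs t). intros x y.
      assert (0 <= (a * y - b * x) * (a * y - b * x)) by apply Rle_0_sqr. nra. }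
    rewrite (Rabs_pos_eq (a' * b')) in H by (apply Rmult_le_pos; assumption).
    assert (0 <= a * b) by (apply Rmult_le_pos; assumption).
    rewrite Rabs_pos_eq in H by (assert (0 <= Rabs (s * t)) by apply Rabs_pos; lra).
    eapply Rle_trans; [apply Rabs_triang|].
    assert (Rabs (dot n u v) <= a * b) by (apply Rabs_le; lra). lra.
Qed.

Lemma norm_vadd (n : nat) (u v : vec) : norm n (vadd u v) <= norm n u + norm n v.
Proof.
  assert (Pu := norm_nonneg n u). assert (Pv := norm_nonneg n v).
  apply Rsqr_incr_0_var; [|lra]. unfold Rsqr.
  rewrite norm_sqr.
  assert (E : dot n (vadd u v) (vadd u v) = dot n u u + 2 * dot n u v + dot n v v).
  { unfold dot. rewrite <- rsum_scal, <- !rsum_plus. apply rsum_ext.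
    intros i _. unfold vadd. ring. }
  rewrite E, <- !norm_sqr.
  assert (H := dot_le_norm n u v). apply Rabs_le_between in H. nra.
Qed.

Lemma norm_vscal (n : nat) (a : R) (v : vec) : norm n (vscal a v) = Rabs a * norm n v.
Proof.
  unfold norm. replace (dot n (vscal a v) (vscal a v)) with (Rsqr a * dot n v v).
  - rewrite sqrt_mult_alt by apply Rle_0_sqr. now rewrite sqrt_Rsqr_abs.
  - unfold dot. rewrite <- rsum_scal. apply rsum_ext. intros i _.
    unfold vscal, Rsqr. ring.
Qed.

Lemma norm_vsub_diag (n : nat) (x : vec) : norm n (vsub x x) = 0.
Proof.
  unfold norm, dot. rewrite (rsum_ext _ _ (fun _ => 0)), rsum_const.
  - rewrite Rmult_0_r. apply sqrt_0.
  - intros i _. unfold vsub. ring.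
Qed.

Lemma norm_vsub_sym (n : nat) (x y : vec) : norm n (vsub x y) = norm n (vsub y x).
Proof.
  unfold norm. f_equal. unfold dot. apply rsum_ext. intros i _. unfold vsub. ring.
Qed.

Lemma norm_vsub_triangle (n : nat) (x y z : vec) :
  norm n (vsub x z) <= norm n (vsub x y) + norm n (vsub y z).
Proof.
  rewrite (norm_ext n (vsub x z) (vadd (vsub x y) (vsub y z))).
  - apply norm_vadd.
  - intros i _. unfold vsub, vadd. ring.
Qed.

Lemma Rabs_coord_le_norm (n : nat) (v : vec) (i : nat) :
  (i < n)%nat -> Rabs (v i) <= norm n v.
Proof.
  intros Hi. rewrite <- (sqrt_Rsqr_abs (v i)). apply sqrt_le_1_alt.
  apply (rsum_term_le n (fun i => v i * v i)); [intros; nra|assumption].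
Qed.

Lemma norm_le_rsum (n : nat) (v : vec) : norm n v <= rsum n (fun i => Rabs (v i)).
Proof.
  assert (P : forall k, 0 <= rsum k (fun i => Rabs (v i)))
    by (intros; apply rsum_nonneg; intros; apply Rabs_pos).
  apply Rsqr_incr_0_var; [|apply P]. unfold Rsqr. rewrite norm_sqr.
  unfold dot. induction n as [|n IH]; simpl; [lra|].
  assert (Q := P n). assert (Qv := Rabs_pos (v n)).
  assert (E : v n * v n = Rabs (v n) * Rabs (v n))
    by (rewrite <- Rabs_mult, Rabs_pos_eq; nra).
  rewrite E. nra.
Qed.

Lemma norm_le_const (n : nat) (v : vec) (b : R) :
  (forall i, (i < n)%nat -> Rabs (v i) <= b) -> norm n v <= INR n * b.
Proof.
  intros H. eapply Rle_trans; [apply norm_le_rsum|].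
  rewrite <- rsum_const. now apply rsum_le.
Qed.

Lemma norm_0_coord (n : nat) (v : vec) (i : nat) :
  norm n v = 0 -> (i < n)%nat -> v i = 0.
Proof.
  intros H Hi. assert (Q := Rabs_coord_le_norm n v i Hi).
  assert (P := Rabs_pos (v i)).
  destruct (Req_dec (v i) 0) as [E|E]; [exact E|].
  apply Rabs_pos_lt in E. lra.
Qed.

(** * Locally Lipschitz functions *)

(** The neighbourhood filter of [z] for the seminorm [norm n]; coordinates of index [n] and above
    are unrestricted. *)
Definition near (n : nat) (z : vec) (Q : vec -> Prop) : Prop :=
  exists d, 0 < d /\ forall x, norm n (vsub x z) < d -> Q x.

Lemma near_and (n : nat) (z : vec) (P Q : vec -> Prop) :
  near n z P -> near n z Q -> near n z (fun x => P x /\ Q x).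
Proof.
  intros [d [Hd HP]] [e [He HQ]]. exists (Rmin d e). split.
  - now apply Rmin_pos.
  - intros x Hx. assert (A := Rmin_l d e). assert (B := Rmin_r d e).
    split; [apply HP|apply HQ]; lra.
Qed.

Lemma near_impl (n : nat) (z : vec) (P Q : vec -> Prop) :
  (forall x, P x -> Q x) -> near n z P -> near n z Q.
Proof. intros H [d [Hd HP]]. exists d; split; auto. Qed.

Lemma near_forall_lt (n m : nat) (z : vec) (Q : nat -> vec -> Prop) :
  (forall i, (i < m)%nat -> near n z (Q i)) ->
  near n z (fun x => forall i, (i < m)%nat -> Q i x).
Proof.
  induction m as [|m IH]; intros H.
  - exists 1. split; [lra|intros; lia].
  - apply (near_impl n z (fun x => (forall i, (i < m)%nat -> Q i x) /\ Q m x)).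
    + intros x [H1 H2] i Hi. destruct (Nat.eq_dec i m) as [->|]; [assumption|apply H1; lia].
    + apply near_and; [apply IH; intros; apply H; lia|apply H; lia].
Qed.

(** The one regularity notion of the proof: it yields continuity, local bounds and the estimates
    behind existence and uniqueness, and it is stable under sums and products. It also forces [g],
    near [z], to depend on the first [n] coordinates only, since points at distance 0 get equal
    values. *)
Definition loc_lip (n : nat) (g : vec -> R) (z : vec) : Prop :=
  exists C, 0 <= C /\ exists d, 0 < d /\
    forall x y, norm n (vsub x z) < d -> norm n (vsub y z) < d ->
      Rabs (g y - g x) <= C * norm n (vsub y x).

Lemma loc_lip_near (n : nat) (g : vec -> R) (z : vec) (eps : R) :
  loc_lip n g z -> 0 < eps -> near n z (fun x => Rabs (g x - g z) <= eps).
Proof.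
  intros [C [HC [d [Hd H]]]] He.
  exists (Rmin d (eps / (C + 1))). split.
  - apply Rmin_pos; [assumption|]. apply Rdiv_lt_0_compat; lra.
  - intros x Hx. assert (A := Rmin_l d (eps / (C + 1))).
    assert (B := Rmin_r d (eps / (C + 1))).
    eapply Rle_trans; [apply H; [rewrite norm_vsub_diag|]; lra|].
    assert (P := norm_nonneg n (vsub x z)).
    assert (E : (C + 1) * (eps / (C + 1)) = eps) by (field; lra).
    assert (norm n (vsub x z) <= eps / (C + 1)) by lra.
    rewrite <- E. nra.
Qed.

Lemma loc_lip_bounded (n : nat) (g : vec -> R) (z : vec) :
  loc_lip n g z -> near n z (fun x => Rabs (g x) <= Rabs (g z) + 1).
Proof.
  intros H. apply (near_impl n z (fun x => Rabs (g x - g z) <= 1)).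
  - intros x Hx. replace (g x) with (g z + (g x - g z)) by ring.
    eapply Rle_trans; [apply Rabs_triang|lra].
  - apply loc_lip_near; [assumption|lra].
Qed.

Lemma loc_lip_const (n : nat) (a : R) (z : vec) : loc_lip n (fun _ => a) z.
Proof.
  exists 0. split; [lra|]. exists 1. split; [lra|]. intros x y _ _.
  rewrite Rminus_diag, Rabs_R0. lra.
Qed.

Lemma loc_lip_plus (n : nat) (g h : vec -> R) (z : vec) :
  loc_lip n g z -> loc_lip n h z -> loc_lip n (fun x => g x + h x) z.
Proof.
  intros [C [HC [d [Hd H]]]] [C' [HC' [d' [Hd' H']]]].
  exists (C + C'). split; [lra|]. exists (Rmin d d'). split; [now apply Rmin_pos|].
  intros x y Hx Hy. assert (A := Rmin_l d d'). assert (B := Rmin_r d d').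
  replace (g y + h y - (g x + h x)) with ((g y - g x) + (h y - h x)) by ring.
  eapply Rle_trans; [apply Rabs_triang|].
  assert (Q := H x y ltac:(lra) ltac:(lra)). assert (Q' := H' x y ltac:(lra) ltac:(lra)). lra.
Qed.

Lemma loc_lip_mult (n : nat) (g h : vec -> R) (z : vec) :
  loc_lip n g z -> loc_lip n h z -> loc_lip n (fun x => g x * h x) z.
Proof.
  intros Hg Hh.
  destruct (near_and n z _ _ (loc_lip_bounded n g z Hg) (loc_lip_bounded n h z Hh))
    as [e [He Hb]].
  destruct Hg as [C [HC [d [Hd H]]]]. destruct Hh as [C' [HC' [d' [Hd' H']]]].
  set (M := Rabs (g z) + 1) in *. set (N := Rabs (h z) + 1) in *.
  assert (0 <= M) by (unfold M; assert (P := Rabs_pos (g z)); lra).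
  assert (0 <= N) by (unfold N; assert (P := Rabs_pos (h z)); lra).
  exists (M * C' + N * C). split; [nra|].
  exists (Rmin e (Rmin d d')). split; [repeat apply Rmin_pos; assumption|].
  intros x y Hx Hy.
  assert (A := Rmin_l e (Rmin d d')). assert (A' := Rmin_r e (Rmin d d')).
  assert (B := Rmin_l d d'). assert (B' := Rmin_r d d').
  replace (g y * h y - g x * h x) with (g y * (h y - h x) + h x * (g y - g x)) by ring.
  eapply Rle_trans; [apply Rabs_triang|]. rewrite !Rabs_mult.
  assert (Q := H x y ltac:(lra) ltac:(lra)). assert (Q' := H' x y ltac:(lra) ltac:(lra)).
  assert (Bg := proj1 (Hb y ltac:(lra))). assert (Bh := proj2 (Hb x ltac:(lra))).
  rewrite Rmult_plus_distr_r, !Rmult_assoc.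
  apply Rplus_le_compat; apply Rmult_le_compat; try assumption; apply Rabs_pos.
Qed.

Lemma loc_lip_rsum (n m : nat) (g : nat -> vec -> R) (z : vec) :
  (forall i, (i < m)%nat -> loc_lip n (g i) z) ->
  loc_lip n (fun x => rsum m (fun i => g i x)) z.
Proof.
  induction m as [|m IH]; intros H; simpl.
  - apply loc_lip_const.
  - apply loc_lip_plus; [apply IH; intros; apply H|apply H]; lia.
Qed.

Lemma loc_lip_congr (n : nat) (g h : vec -> R) (z : vec) :
  near n z (fun x => g x = h x) -> loc_lip n g z -> loc_lip n h z.
Proof.
  intros [e [He E]] [C [HC [d [Hd H]]]]. exists C. split; [assumption|].
  exists (Rmin e d). split; [now apply Rmin_pos|]. intros x y Hx Hy.
  assert (A := Rmin_l e d). assert (B := Rmin_r e d).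
  rewrite <- !E by lra. apply H; lra.
Qed.

(** * Derivatives along lines, and the passage from C^1 to locally Lipschitz *)

Lemma is_derive_rsum (m : nat) (g : nat -> R -> R) (l : nat -> R) (s : R) :
  (forall i, (i < m)%nat -> is_derive (g i) s (l i)) ->
  is_derive (fun s => rsum m (fun i => g i s)) s (rsum m l).
Proof.
  induction m as [|m IH]; intros H; simpl.
  - apply (is_derive_const 0).
  - apply (is_derive_plus (fun s => rsum m (fun i => g i s)) (g m));
      [apply IH; intros; apply H|apply H]; lia.
Qed.

Lemma mulmv_vscal (n : nat) (A : mat) (a : R) (v : vec) (i : nat) :
  mulmv n A (vscal a v) i = a * mulmv n A v i.
Proof.
  unfold mulmv. rewrite <- rsum_scal. apply rsum_ext. intros; unfold vscal; ring.
Qed.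

(** Restriction to a line turns the derivative matrix into an ordinary real derivative, to which the
    mean value theorem and the calculus rules apply. *)
Lemma has_deriv_line (n m : nat) (g : vec -> vec) (x v : vec) (J : mat) (s : R) (i : nat) :
  has_deriv_at n m g (vadd x (vscal s v)) J -> (i < m)%nat ->
  is_derive (fun s => g (vadd x (vscal s v)) i) s (mulmv n J v i).
Proof.
  intros H Hi. apply is_derive_Reals. intros eps Heps.
  assert (Pv := norm_nonneg n v).
  (* The denominator is positive even for [v = 0], and it makes the final bound strictly smaller
     than [eps * Rabs h]. *)
  destruct (H (eps / (2 * (norm n v + 1)))) as [d [Hd Hb]].
  { apply Rdiv_lt_0_compat; lra. }
  assert (Hd' : 0 < d / (norm n v + 1)) by (apply Rdiv_lt_0_compat; lra).
  exists (mkposreal _ Hd'). intros h Hh Hhd. simpl in Hhd.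
  assert (Ph := Rabs_pos_lt h Hh).
  assert (Hn : norm n (vscal h v) < d).
  { rewrite norm_vscal. replace d with (d / (norm n v + 1) * (norm n v + 1)) by (field; lra).
    nra. }
  specialize (Hb (vscal h v) Hn).
  eapply Rle_trans in Hb; [|apply (Rabs_coord_le_norm m _ i Hi)].
  unfold vsub at 1 2 in Hb. rewrite mulmv_vscal, norm_vscal in Hb.
  replace (vadd (vadd x (vscal s v)) (vscal h v)) with (vadd x (vscal (s + h) v)) in Hb
    by (apply functional_extensionality; intros k; unfold vadd, vscal; ring).
  set (D := g (vadd x (vscal (s + h) v)) i - g (vadd x (vscal s v)) i) in *.
  replace (D / h - mulmv n J v i) with ((D - h * mulmv n J v i) * / h) by (field; assumption).
  rewrite Rabs_mult, Rabs_inv.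
  apply (Rmult_lt_reg_r (Rabs h)); [assumption|].
  rewrite Rmult_assoc, Rinv_l, Rmult_1_r by lra.
  eapply Rle_lt_trans; [apply Hb|].
  replace (eps / (2 * (norm n v + 1)) * (Rabs h * norm n v))
    with (eps * Rabs h * (norm n v / (2 * (norm n v + 1)))) by (field; lra).
  assert (norm n v / (2 * (norm n v + 1)) < 1).
  { apply (Rmult_lt_reg_r (2 * (norm n v + 1))); [lra|].
    replace (norm n v / (2 * (norm n v + 1)) * (2 * (norm n v + 1))) with (norm n v) by (field; lra).
    lra. }
  assert (0 < eps * Rabs h) by (apply Rmult_lt_0_compat; assumption). nra.
Qed.

(** Mean value theorem on the segment from [x] to [y], which stays in a ball around [z] because
    balls are convex. On that ball each partial derivative exceeds its absolute value at [z] by at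
    most 1, whence the constant. *)
Lemma C1_on_loc_lip (n m : nat) (U : vset) (g : vec -> vec) (z : vec) (i : nat) :
  is_open n U -> C1_on n m U g -> U z -> (i < m)%nat -> loc_lip n (fun x => g x i) z.
Proof.
  intros HU [Dg [HD HC]] Hz Hi.
  destruct (HU z Hz) as [d0 [Hd0 Hball]].
  assert (Hb : near n z (fun x => forall j, (j < n)%nat -> Rabs (Dg x i j) <= Rabs (Dg z i j) + 1)).
  { apply near_forall_lt. intros j Hj.
    destruct (HC i j Hi Hj z Hz 1 ltac:(lra)) as [d [Hd Hc]].
    exists (Rmin d0 d). split; [now apply Rmin_pos|]. intros x Hx.
    assert (A := Rmin_l d0 d). assert (B := Rmin_r d0 d).
    specialize (Hc x (Hball x ltac:(lra)) ltac:(lra)).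
    replace (Dg x i j) with (Dg z i j + (Dg x i j - Dg z i j)) by ring.
    eapply Rle_trans; [apply Rabs_triang|lra]. }
  destruct Hb as [d [Hd Hb]].
  set (C := rsum n (fun j => Rabs (Dg z i j) + 1)).
  exists C. split.
  { apply rsum_nonneg. intros j _. assert (P := Rabs_pos (Dg z i j)). lra. }
  exists (Rmin d0 d). split; [now apply Rmin_pos|]. intros x y Hx Hy.
  assert (A := Rmin_l d0 d). assert (B := Rmin_r d0 d).
  set (v := vsub y x).
  assert (Hseg : forall s, 0 <= s <= 1 -> norm n (vsub (vadd x (vscal s v)) z) < Rmin d0 d).
  { intros s Hs.
    rewrite (norm_ext n _ (vadd (vscal (1 - s) (vsub x z)) (vscal s (vsub y z)))).
    2:{ intros k _. unfold v, vsub, vadd, vscal. ring. }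
    eapply Rle_lt_trans; [apply norm_vadd|]. rewrite !norm_vscal, !Rabs_pos_eq by lra.
    set (q := Rmax (norm n (vsub x z)) (norm n (vsub y z))).
    assert (Hq : q < Rmin d0 d) by now apply Rmax_lub_lt.
    assert (Q := Rmult_le_compat_l (1 - s) _ q ltac:(lra) (Rmax_l _ _)).
    assert (Q' := Rmult_le_compat_l s _ q ltac:(lra) (Rmax_r _ _)). lra. }
  destruct (MVT_gen (fun s => g (vadd x (vscal s v)) i) 0 1
              (fun s => mulmv n (Dg (vadd x (vscal s v))) v i)) as [s [Hs E]].
  - rewrite Rmin_left, Rmax_right by lra. intros s Hs.
    apply (has_deriv_line n m); [|assumption]. apply HD, Hball.
    assert (Q := Hseg s ltac:(lra)). lra.
  - rewrite Rmin_left, Rmax_right by lra. intros s Hs.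
    apply derivable_continuous_pt. exists (mulmv n (Dg (vadd x (vscal s v))) v i).
    apply is_derive_Reals. apply (has_deriv_line n m); [|assumption]. apply HD, Hball.
    assert (Q := Hseg s ltac:(lra)). lra.
  - rewrite Rmin_left, Rmax_right in Hs by lra.
    replace (vadd x (vscal 1 v)) with y in E
      by (apply functional_extensionality; intros k; unfold v, vadd, vscal, vsub; ring).
    replace (vadd x (vscal 0 v)) with x in E
      by (apply functional_extensionality; intros k; unfold v, vadd, vscal, vsub; ring).
    rewrite E, Rminus_0_r, Rmult_1_r. unfold mulmv.
    eapply Rle_trans; [apply rsum_Rabs|]. unfold C.
    rewrite Rmult_comm, <- rsum_scal. apply rsum_le. intros j Hj.
    rewrite Rabs_mult, Rmult_comm. apply Rmult_le_compat; try apply Rabs_pos.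
    + now apply Rabs_coord_le_norm.
    + apply Hb; [|assumption]. assert (Q := Hseg s ltac:(lra)). lra.
Qed.

Lemma dot_mulmv_sym (m : nat) (K : mat) (u v : vec) : symmetric m K ->
  dot m u (mulmv m K v) = dot m v (mulmv m K u).
Proof.
  intros HK. unfold dot, mulmv.
  rewrite (rsum_ext m _ (fun i => rsum m (fun j => u i * (K i j * v j))))
    by (intros; now rewrite rsum_scal).
  rewrite rsum_swap. apply rsum_ext. intros j Hj. rewrite <- rsum_scal.
  apply rsum_ext. intros i Hi. rewrite (HK i j Hi Hj). ring.
Qed.

(** Both sides are the derivative at [s = 0] of [V (x + s v)], computed once from the gradient and
    once by the product rule through [f]. Symmetry of [K] merges the two halves of the product rule
    and cancels the factor 1/2. *)
Lemma Lyap_gradient (n m : nat) (K : mat) (f : vec -> vec) (x0 x : vec) (D : mat) (gv v : vec) :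
  symmetric m K -> has_deriv_at n m f x D -> is_gradient n (Lyap m K f x0) x gv ->
  dot n gv v = dot m (mulmv n D v) (mulmv m K (vsub (f x) (f x0))).
Proof.
  intros HK Hf HV.
  assert (Ex : vadd x (vscal 0 v) = x)
    by (apply functional_extensionality; intros k; unfold vadd, vscal; ring).
  set (d := fun s => vsub (f (vadd x (vscal s v))) (f x0)).
  set (d' := mulmv n D v).
  assert (H1 : is_derive (fun s => Lyap m K f x0 (vadd x (vscal s v))) 0 (dot n gv v)).
  { unfold is_gradient in HV. rewrite <- Ex in HV.
    exact (has_deriv_line n 1 _ x v _ 0 0%nat HV Nat.lt_0_1). }
  assert (Hd : forall i, (i < m)%nat -> is_derive (fun s => d s i) 0 (d' i)).
  { intros i Hi. rewrite <- Ex in Hf.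
    assert (Q := has_deriv_line n m f x v D 0 i Hf Hi).
    unfold d, vsub. rewrite <- (Rminus_0_r (d' i)).
    apply (is_derive_minus (fun s => f (vadd x (vscal s v)) i) (fun _ => f x0 i) 0 (d' i) 0);
      [exact Q|apply (is_derive_const (f x0 i))]. }
  assert (H2 : is_derive (fun s => Lyap m K f x0 (vadd x (vscal s v))) 0
      (/ 2 * rsum m (fun i => d' i * mulmv m K (d 0) i + d 0 i * mulmv m K d' i))).
  { unfold Lyap. fold (d 0). apply (is_derive_scal (fun s => dot m (d s) (mulmv m K (d s)))).
    unfold dot. apply is_derive_rsum. intros i Hi.
    apply (is_derive_mult (fun s => d s i) (fun s => mulmv m K (d s) i)).
    - now apply Hd.
    - unfold mulmv. apply is_derive_rsum. intros j Hj.
      apply (is_derive_scal (fun s => d s j)). now apply Hd.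
    - intros; apply Rmult_comm. }
  apply is_derive_unique in H1. apply is_derive_unique in H2. rewrite <- H1, H2.
  rewrite rsum_plus. fold (dot m d' (mulmv m K (d 0))) (dot m (d 0) (mulmv m K d')).
  rewrite (dot_mulmv_sym m K (d 0) d' HK).
  unfold d at 1 2. rewrite Ex. field.
Qed.

(** * Estimates near the zero set *)

Lemma functional_choice_on (A B : Type) (Q : A -> B -> Prop) :
  (forall a, exists b, Q a b) -> exists g : A -> B, forall a, Q a (g a).
Proof.
  intros H. exists (fun a => proj1_sig (constructive_indefinite_description _ (H a))).
  intros a. apply proj2_sig.
Qed.

(* Surjectivity of [Df z] provides preimages [v_i] of the unit vectors; near [z] the vectors
   [Df x v_i] still dominate [w = K (f x - f x0)] diagonally, so the numbers
   [dot gV v_i = dot (Df x v_i) w] control [w]. *)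
Lemma Lyap_le_gradient (n m : nat) (K : mat) (f : vec -> vec) (Df : vec -> mat)
  (x0 : vec) (gV : vec -> vec) (z : vec) :
  symmetric m K ->
  near n z (fun x => has_deriv_at n m f x (Df x) /\ is_gradient n (Lyap m K f x0) x (gV x)) ->
  (forall i, (i < m)%nat -> loc_lip n (fun x => f x i) z) ->
  (forall i j, (i < m)%nat -> (j < n)%nat -> loc_lip n (fun x => Df x i j) z) ->
  onto n m (Df z) ->
  exists C, 0 <= C /\ near n z (fun x => Lyap m K f x0 x <= C * norm n (gV x)).
Proof.
  intros HK Hder Hf HDf Honto.
  destruct (functional_choice_on nat vec
    (fun i v => forall k, (k < m)%nat ->
       mulmv n (Df z) v k = if Nat.eq_dec k i then 1 else 0)) as [v Hv].
  { intros i. apply (Honto (fun k => if Nat.eq_dec k i then 1 else 0)). }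
  assert (Pm := pos_INR m).
  (* Chosen so that the [m] error terms, each at most [eta * s], add up to at most [s / 2] and are
     absorbed into the left side. *)
  set (eta := / (2 * (INR m + 1))).
  assert (Heta : 0 < eta) by (apply Rinv_0_lt_compat; lra).
  assert (Hmeta : INR m * eta <= / 2).
  { unfold eta. apply (Rmult_le_reg_r (2 * (INR m + 1))); [lra|].
    rewrite Rmult_assoc, Rinv_l by lra. lra. }
  assert (Hclose : near n z (fun x => forall i, (i < m)%nat -> forall k, (k < m)%nat ->
     Rabs (mulmv n (Df x) (v i) k - (if Nat.eq_dec k i then 1 else 0)) <= eta)).
  { apply near_forall_lt. intros i Hi. apply near_forall_lt. intros k Hk.
    rewrite <- (Hv i k Hk).
    apply (loc_lip_near n (fun x => mulmv n (Df x) (v i) k)); [|assumption].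
    unfold mulmv. apply loc_lip_rsum. intros j Hj.
    apply loc_lip_mult; [now apply HDf|apply loc_lip_const]. }
  assert (Hbd : near n z (fun x => forall i, (i < m)%nat ->
     Rabs (f x i - f x0 i) <= Rabs (f z i) + 1 + Rabs (f x0 i))).
  { apply near_forall_lt. intros i Hi.
    apply (near_impl n z (fun x => Rabs (f x i) <= Rabs (f z i) + 1)).
    - intros x Hx. unfold Rminus. eapply Rle_trans; [apply Rabs_triang|].
      rewrite Rabs_Ropp. lra.
    - apply (loc_lip_bounded n (fun x => f x i)). now apply Hf. }
  set (B := rsum m (fun i => norm n (v i))).
  set (D := rsum m (fun i => Rabs (f z i) + 1 + Rabs (f x0 i))).
  assert (HB : 0 <= B) by (apply rsum_nonneg; intros; apply norm_nonneg).
  assert (HDi : forall i, 0 <= Rabs (f z i) + 1 + Rabs (f x0 i)).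
  { intros i. assert (P := Rabs_pos (f z i)). assert (P' := Rabs_pos (f x0 i)). lra. }
  assert (HD : 0 <= D) by (apply rsum_nonneg; intros; apply HDi).
  (* [V] is half of [dot m d w], hence at most [D * s / 2], and [s] is at most [2 * B] times the
     norm of the gradient. *)
  exists (D * B). split; [now apply Rmult_le_pos|].
  eapply near_impl; [|apply (near_and _ _ _ _ Hder (near_and _ _ _ _ Hclose Hbd))].
  intros x [[Hfx HVx] [Hc Hb]].
  set (d := vsub (f x) (f x0)). set (w := mulmv m K d).
  set (s := rsum m (fun i => Rabs (w i))).
  assert (Hw : forall i, (i < m)%nat -> Rabs (w i) <= norm n (gV x) * norm n (v i) + eta * s).
  { intros i Hi.
    assert (E := Lyap_gradient n m K f x0 x (Df x) (gV x) (v i) HK Hfx HVx).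
    fold d w in E.
    assert (E' : w i = dot n (gV x) (v i) -
       rsum m (fun k => w k * (mulmv n (Df x) (v i) k - (if Nat.eq_dec k i then 1 else 0)))).
    { rewrite E. unfold dot. rewrite <- rsum_minus, <- (rsum_delta m i w Hi).
      apply rsum_ext. intros; ring. }
    rewrite E'. unfold Rminus at 1. eapply Rle_trans; [apply Rabs_triang|].
    rewrite Rabs_Ropp. apply Rplus_le_compat; [apply dot_le_norm|].
    eapply Rle_trans; [apply rsum_Rabs|]. unfold s. rewrite <- rsum_scal.
    apply rsum_le. intros k Hk. rewrite Rabs_mult, Rmult_comm.
    apply Rmult_le_compat_r; [apply Rabs_pos|now apply Hc]. }
  assert (Hs : s <= 2 * (norm n (gV x) * B)).
  { assert (Q : s <= norm n (gV x) * B + INR m * (eta * s)).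
    { unfold B. rewrite <- rsum_scal, <- rsum_const, <- rsum_plus.
      now apply rsum_le. }
    assert (0 <= s) by (apply rsum_nonneg; intros; apply Rabs_pos).
    assert (INR m * eta * s <= / 2 * s) by now apply Rmult_le_compat_r. lra. }
  assert (HV : dot m d w <= D * s).
  { eapply Rle_trans; [apply Rle_abs|]. eapply Rle_trans; [apply rsum_Rabs|].
    unfold s. rewrite <- rsum_scal. apply rsum_le. intros i Hi.
    rewrite Rabs_mult. apply Rmult_le_compat_r; [apply Rabs_pos|].
    eapply Rle_trans; [apply (Hb i Hi)|].
    apply (rsum_term_le m (fun i => Rabs (f z i) + 1 + Rabs (f x0 i))); auto. }
  unfold Lyap. fold d w.
  assert (D * s <= D * (2 * (norm n (gV x) * B))) by now apply Rmult_le_compat_l.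
  lra.
Qed.

(** A Lebesgue number argument: the balls of the cover have half the valid radius, so a point within
    the smallest half radius of [Z] still lies in a full ball. Monotonicity lets the largest of
    finitely many constants serve everywhere. *)
Lemma compact_uniform (n : nat) (Z : vset) (P : vec -> R -> Prop) :
  is_compact n Z ->
  (forall x C C', C <= C' -> P x C -> P x C') ->
  (forall z, Z z -> exists C, near n z (fun x => P x C)) ->
  exists r C, 0 < r /\ 0 < C /\ forall z x, Z z -> norm n (vsub x z) < r -> P x C.
Proof.
  intros HZ Hmono Hloc.
  (* The cover is indexed by all triples of centre, radius and constant. An invalid triple
     contributes the empty set, so neither radius nor constant has to be chosen as a function of the
     point. *)
  set (valid := fun q : vec * R * R => 0 < snd (fst q) /\
    forall x, norm n (vsub x (fst (fst q))) < snd (fst q) -> P x (snd q)).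
  destruct (HZ (vec * R * R)%type (fun q x => valid q /\
     norm n (vsub x (fst (fst q))) < snd (fst q) / 2)) as [l Hl].
  - intros q x [Hq Hx]. exists (snd (fst q) / 2 - norm n (vsub x (fst (fst q)))).
    split; [lra|]. intros y Hy. split; [assumption|].
    assert (T := norm_vsub_triangle n y x (fst (fst q))). lra.
  - intros z Hz. destruct (Hloc z Hz) as [C [d [Hd H]]].
    exists (z, d, C). unfold valid; simpl. rewrite norm_vsub_diag.
    repeat split; [assumption|assumption|lra].
  - assert (Hfin : exists r C, 0 < r /\ 0 < C /\
       forall q, In q l -> valid q -> r <= snd (fst q) / 2 /\ snd q <= C).
    { clear Hl. induction l as [|q l [r [C [Hr [HC H]]]]].
      - exists 1, 1. split; [lra|]. split; [lra|]. intros q [].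
      (* The finite subfamily may list invalid triples; the minimum and the maximum skip them. *)
      - destruct (excluded_middle_informative (valid q)) as [Hq|Hq].
        + exists (Rmin r (snd (fst q) / 2)), (Rmax C (snd q)).
          split; [apply Rmin_pos; [assumption|destruct Hq; lra]|].
          split; [eapply Rlt_le_trans; [apply HC|apply Rmax_l]|].
          intros p [<-|Hp] Vp.
          * split; [apply Rmin_r|apply Rmax_r].
          * destruct (H p Hp Vp). split; [eapply Rle_trans; [apply Rmin_l|]|
              eapply Rle_trans; [|apply Rmax_l]]; assumption.
        + exists r, C. split; [assumption|]. split; [assumption|].
          intros p [<-|Hp] Vp; [contradiction|now apply H]. }
    destruct Hfin as [r [C [Hr [HC H]]]]. exists r, C. split; [assumption|].
    split; [assumption|]. intros z x Hz Hx.
    destruct (Hl z Hz) as [q [Hq [Vq Hzq]]]. destruct (H q Hq Vq) as [H1 H2].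
    apply (Hmono x (snd q)); [assumption|]. apply Vq.
    assert (T := norm_vsub_triangle n x z (fst (fst q))). lra.
Qed.

(** * Cluster points of bounded sequences *)

Lemma bounded_subsequence (u : nat -> R) (C : R) : (forall k, Rabs (u k) <= C) ->
  exists (l : R) (phi : nat -> nat),
    (forall k, (k <= phi k)%nat) /\ is_lim_seq (fun k => u (phi k)) l.
Proof.
  intros Hu.
  destruct (Bolzano_Weierstrass u (fun x => - C <= x <= C)) as [l Hl].
  - apply compact_P3.
  - intros k. apply Rabs_le_between, Hu.
  - destruct (functional_choice_on nat nat
      (fun k p => (k <= p)%nat /\ Rabs (u p - l) < / (INR k + 1))) as [phi Hphi].
    { intros k. assert (Hk : 0 < / (INR k + 1))
        by (apply Rinv_0_lt_compat; assert (P := pos_INR k); lra).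
      apply (Hl (disc l (mkposreal _ Hk))).
      exists (mkposreal _ Hk). intros x Hx; exact Hx. }
    exists l, phi. split; [intros k; apply Hphi|].
    assert (H0 : is_lim_seq (fun k => / (INR k + 1)) 0).
    { apply (is_lim_seq_ext (fun k => / INR (S k))).
      - intros k. now rewrite S_INR.
      - replace (Finite 0) with (Rbar_inv p_infty) by reflexivity.
        apply is_lim_seq_inv; [|discriminate].
        apply -> is_lim_seq_incr_1. apply is_lim_seq_INR. }
    apply (is_lim_seq_le_le (fun k => l - / (INR k + 1)) _ (fun k => l + / (INR k + 1))).
    + intros k. destruct (Hphi k) as [_ H]. apply Rabs_def2 in H. lra.
    + replace (Finite l) with (Finite (l - 0)) by (f_equal; ring).
      apply is_lim_seq_minus'; [apply is_lim_seq_const|exact H0].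
    + replace (Finite l) with (Finite (l + 0)) by (f_equal; ring).
      apply is_lim_seq_plus'; [apply is_lim_seq_const|exact H0].
Qed.

Lemma eventually_forall_lt (n : nat) (Q : nat -> nat -> Prop) :
  (forall i, (i < n)%nat -> eventually (Q i)) ->
  eventually (fun k => forall i, (i < n)%nat -> Q i k).
Proof.
  induction n as [|n IH]; intros H.
  - exists 0%nat. intros; lia.
  - destruct (IH (fun i Hi => H i ltac:(lia))) as [N HN].
    destruct (H n ltac:(lia)) as [N' HN'].
    exists (max N N'). intros k Hk i Hi.
    destruct (Nat.eq_dec i n) as [->|]; [apply HN'|apply HN]; lia.
Qed.

(** One further extraction per coordinate. The condition [k <= phi k] stands in for strict
    monotonicity: it makes [phi] tend to infinity and survives composition. *)
Lemma bounded_subsequence_vec (n : nat) (u : nat -> vec) (C : R) :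
  (forall k i, (i < n)%nat -> Rabs (u k i) <= C) ->
  exists (l : vec) (phi : nat -> nat), (forall k, (k <= phi k)%nat) /\
    forall i, (i < n)%nat -> is_lim_seq (fun k => u (phi k) i) (l i).
Proof.
  induction n as [|n IH]; intros Hu.
  - exists (fun _ => 0), (fun k => k). split; [auto|intros; lia].
  - destruct IH as [l [phi [Hphi Hl]]]; [intros; apply Hu; lia|].
    destruct (bounded_subsequence (fun k => u (phi k) n) C) as [a [psi [Hpsi Ha]]].
    { intros k; apply Hu; lia. }
    exists (fun i => if Nat.eq_dec i n then a else l i), (fun k => phi (psi k)).
    split; [intros k; eapply Nat.le_trans; [apply Hpsi|apply Hphi]|].
    intros i Hi. destruct (Nat.eq_dec i n) as [->|Hn]; [exact Ha|].
    apply (is_lim_seq_subseq (fun k => u (phi k) i)); [|apply Hl; lia].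
    intros Q [N HN]. exists N. intros k Hk. apply HN.
    specialize (Hpsi k). lia.
Qed.

Lemma bounded_cluster_point (n : nat) (u : nat -> vec) (C : R) :
  (forall k i, (i < n)%nat -> Rabs (u k i) <= C) ->
  exists l : vec, forall eps N, 0 < eps ->
    exists k, (N <= k)%nat /\ norm n (vsub (u k) l) < eps.
Proof.
  intros Hu. destruct (bounded_subsequence_vec n u C Hu) as [l [phi [Hphi Hl]]].
  exists l. intros eps N Heps. assert (Pn := pos_INR n).
  assert (He : 0 < eps / (INR n + 1)) by (apply Rdiv_lt_0_compat; lra).
  destruct (eventually_forall_lt n
    (fun i k => Rabs (u (phi k) i - l i) < eps / (INR n + 1))) as [M HM].
  { intros i Hi. assert (Q := Hl i Hi). apply is_lim_seq_spec in Q.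
    exact (Q (mkposreal _ He)). }
  exists (phi (max N M)). split; [specialize (Hphi (max N M)); lia|].
  eapply Rle_lt_trans.
  - apply (norm_le_const n _ (eps / (INR n + 1))). intros i Hi.
    apply Rlt_le. apply HM; [lia|assumption].
  - replace eps with ((INR n + 1) * (eps / (INR n + 1))) at 2 by (field; lra). lra.
Qed.

(** Otherwise there are points of [W] with values tending to 0 that stay at distance [eps] from the
    zeros. As [W] is bounded they have a cluster point; the margin [rho] puts it in [U], even if it
    is not in [W], and continuity makes it a zero of [V]. The lemma serves twice: for the choice of
    [c] and for the convergence to the zero set. *)
Lemma small_value_near_zero_set (n : nat) (U W : vset) (V : vec -> R) (C rho : R) :
  continuous_on n U V -> (forall x, 0 <= V x) -> 0 < rho ->
  (forall x i, W x -> (i < n)%nat -> Rabs (x i) <= C) ->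
  (forall x y, W x -> norm n (vsub y x) < rho -> U y) ->
  forall eps, 0 < eps -> exists c, 0 < c /\
    forall x, W x -> V x <= c -> exists z, (U z /\ V z = 0) /\ norm n (vsub x z) < eps.
Proof.
  intros HV Hpos Hrho Hbd HU eps Heps. apply NNPP. intros Hno.
  assert (Hk : forall k, exists x, W x /\ V x <= / (INR k + 1) /\
     forall z, U z -> V z = 0 -> ~ norm n (vsub x z) < eps).
  { intros k. apply NNPP. intros Hk. apply Hno. exists (/ (INR k + 1)).
    split; [apply Rinv_0_lt_compat; assert (P := pos_INR k); lra|].
    intros x Hx HVx. apply NNPP. intros Hz. apply Hk. exists x.
    split; [assumption|]. split; [assumption|]. intros z Uz Vz Hn. apply Hz.
    exists z. auto. }
  apply functional_choice_on in Hk. destruct Hk as [u Hu].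
  destruct (bounded_cluster_point n u C) as [l Hl].
  { intros k i Hi. apply Hbd; [apply Hu|assumption]. }
  assert (Ul : U l).
  { destruct (Hl rho 0%nat Hrho) as [k [_ Hk]]. apply (HU (u k)); [apply Hu|].
    now rewrite norm_vsub_sym. }
  assert (Vl : V l = 0).
  { apply Rle_antisym; [|apply Hpos]. apply le_epsilon. intros e He.
    destruct (HV l Ul (e / 2) ltac:(lra)) as [d [Hd Hc]].
    assert (HN : exists N, / (INR N + 1) < e / 2).
    { destruct (archimed_cor1 (e / 2) ltac:(lra)) as [N [HN HN']].
      exists N. eapply Rlt_trans; [|exact HN]. apply Rinv_lt_contravar; [|lra].
      apply lt_0_INR in HN'. nra. }
    destruct HN as [N HN].
    destruct (Hl (Rmin d rho) N) as [k [Hk Hn]]; [now apply Rmin_pos|].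
    assert (A := Rmin_l d rho). assert (B := Rmin_r d rho).
    destruct (Hu k) as [Wk [Vk _]].
    assert (Uk : U (u k)) by (apply (HU (u k)); [assumption|rewrite norm_vsub_diag; lra]).
    specialize (Hc (u k) Uk ltac:(lra)). apply Rabs_def2 in Hc.
    assert (/ (INR k + 1) <= / (INR N + 1)).
    { apply Rinv_le_contravar; [assert (P := pos_INR N); lra|].
      apply le_INR in Hk. lra. }
    lra. }
  destruct (Hl eps 0%nat Heps) as [k [_ Hk]].
  now apply (proj2 (proj2 (Hu k)) l).
Qed.

(** * Flows of bounded Lipschitz fields *)

(* McShane's extension [x |-> sup_a (g a - L |x - a|)], truncated below at [- M]. *)
Lemma lipschitz_extension (n : nat) (A : vset) (g : vec -> R) (L M : R) :
  (exists a, A a) -> 0 <= L ->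
  (forall x, A x -> Rabs (g x) <= M) ->
  (forall x y, A x -> A y -> Rabs (g y - g x) <= L * norm n (vsub y x)) ->
  exists G : vec -> R, (forall x, A x -> G x = g x) /\ (forall x, Rabs (G x) <= M) /\
    (forall x y, Rabs (G y - G x) <= L * norm n (vsub y x)).
Proof.
  intros [a0 Ha0] HL HM Hlip.
  destruct (functional_choice_on vec R
    (fun x l => is_lub (fun v => exists a, A a /\ v = g a - L * norm n (vsub x a)) l))
    as [G0 HG0].
  { intros x. destruct (completeness (fun v => exists a, A a /\ v = g a - L * norm n (vsub x a)))
      as [l Hl]; [| |now exists l].
    - exists M. intros v [a [Ha ->]]. specialize (HM a Ha). apply Rabs_le_between in HM.
      assert (P := Rmult_le_pos _ _ HL (norm_nonneg n (vsub x a))). lra.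
    - exists (g a0 - L * norm n (vsub x a0)), a0. auto. }
  assert (Hle : forall x y, G0 y <= G0 x + L * norm n (vsub y x)).
  { intros x y. apply (proj2 (HG0 y)). intros v [a [Ha ->]].
    assert (Q := proj1 (HG0 x) (g a - L * norm n (vsub x a)) ltac:(now exists a)).
    assert (T := Rmult_le_compat_l L _ _ HL (norm_vsub_triangle n x y a)).
    rewrite (norm_vsub_sym n x y) in T. lra. }
  assert (HA : forall x, A x -> G0 x = g x).
  { intros x Hx. apply Rle_antisym.
    - apply (proj2 (HG0 x)). intros v [a [Ha ->]].
      assert (Q := Hlip x a Hx Ha). rewrite norm_vsub_sym in Q.
      apply Rabs_le_between in Q. lra.
    - apply (proj1 (HG0 x)). exists x. rewrite norm_vsub_diag. split; [assumption|ring]. }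
  assert (HM0 : 0 <= M) by (eapply Rle_trans; [apply Rabs_pos|apply (HM a0 Ha0)]).
  (* The bound by [M] from above is inherited from the terms of the supremum, and taking a maximum
     with a constant keeps the Lipschitz constant. *)
  exists (fun x => Rmax (- M) (G0 x)). split; [|split].
  - intros x Hx. rewrite (HA x Hx). apply Rmax_right.
    specialize (HM x Hx). apply Rabs_le_between in HM. lra.
  - intros x. apply Rabs_le. split; [apply Rmax_l|]. apply Rmax_lub; [lra|].
    apply (proj2 (HG0 x)). intros v [a [Ha ->]]. specialize (HM a Ha).
    apply Rabs_le_between in HM.
    assert (P := Rmult_le_pos _ _ HL (norm_nonneg n (vsub x a))). lra.
  - intros x y. assert (H1 := Hle x y). assert (H2 := Hle y x).
    rewrite (norm_vsub_sym n x y) in H2.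
    assert (P := Rmult_le_pos _ _ HL (norm_nonneg n (vsub y x))).
    apply Rabs_le. unfold Rmax. destruct (Rle_dec (- M) (G0 x)), (Rle_dec (- M) (G0 y)); lra.
Qed.

Lemma is_derive_lipschitz (g g' : R -> R) (M : R) :
  (forall t, is_derive g t (g' t)) -> (forall t, Rabs (g' t) <= M) ->
  forall s t, Rabs (g s - g t) <= M * Rabs (s - t).
Proof.
  intros Hg HM s t. destruct (MVT_gen g t s g') as [c [_ E]].
  - intros; apply Hg.
  - intros x _. apply derivable_continuous_pt. exists (g' x). apply is_derive_Reals, Hg.
  - rewrite E, Rabs_mult. apply Rmult_le_compat_r; [apply Rabs_pos|apply HM].
Qed.

Lemma lipschitz_continuous (g : R -> R) (C : R) :
  (forall s t, Rabs (g s - g t) <= C * Rabs (s - t)) -> forall t, continuous g t.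
Proof.
  intros H t. apply continuity_pt_filterlim. intros eps Heps.
  assert (0 <= C).
  { assert (Q := H 1 0). rewrite Rminus_0_r, Rabs_R1, Rmult_1_r in Q.
    eapply Rle_trans; [apply Rabs_pos|exact Q]. }
  exists (eps / (C + 1)). split; [apply Rdiv_lt_0_compat; lra|].
  intros s [_ Hs]. simpl in *. unfold R_dist in *.
  eapply Rle_lt_trans; [apply H|].
  assert (P := Rabs_pos (s - t)).
  replace eps with ((C + 1) * (eps / (C + 1))) by (field; lra).
  assert (0 < eps / (C + 1)) by (apply Rdiv_lt_0_compat; lra). nra.
Qed.

(** For [h = g] and [h = - g] the difference [A * exp (kappa * t) - h t] is nonnegative at 0 and has
    nonnegative derivative for [t >= 0]. This replaces integrating the bound on [g']. *)
Lemma exp_domination (g g' : R -> R) (A kappa : R) :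
  (forall t, is_derive g t (g' t)) -> Rabs (g 0) <= A ->
  (forall t, 0 <= t -> Rabs (g' t) <= A * kappa * exp (kappa * t)) ->
  forall t, 0 <= t -> Rabs (g t) <= A * exp (kappa * t).
Proof.
  intros Hg H0 Hb t Ht.
  assert (Hone : forall h h' : R -> R, (forall t, is_derive h t (h' t)) -> h 0 <= A ->
     (forall t, 0 <= t -> h' t <= A * kappa * exp (kappa * t)) -> h t <= A * exp (kappa * t)).
  { intros h h' Hh Hh0 Hhb.
    assert (Hd : forall s, is_derive (fun s => A * exp (kappa * s) - h s) s
       (A * kappa * exp (kappa * s) - h' s)).
    { intros s. apply (is_derive_minus (fun s => A * exp (kappa * s)) h); [|apply Hh].
      auto_derive; [trivial|ring]. }
    destruct (MVT_gen (fun s => A * exp (kappa * s) - h s) 0 t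
       (fun s => A * kappa * exp (kappa * s) - h' s)) as [c [Hc E]].
    - intros; apply Hd.
    - intros x _. apply derivable_continuous_pt. eexists. apply is_derive_Reals, Hd.
    - rewrite Rmin_left in Hc by lra. rewrite Rmult_0_r, exp_0 in E.
      specialize (Hhb c ltac:(lra)).
      assert (0 <= (A * kappa * exp (kappa * c) - h' c) * (t - 0))
        by (apply Rmult_le_pos; lra).
      lra. }
  apply Rabs_le_between in H0. apply Rabs_le. split.
  - enough (- g t <= A * exp (kappa * t)) by lra.
    apply (Hone (fun t => - g t) (fun t => - g' t)).
    + intros s. apply (is_derive_opp g), Hg.
    + lra.
    + intros s Hs. specialize (Hb s Hs). apply Rabs_le_between in Hb. lra.
  - apply (Hone g g'); [assumption|lra|].
    intros s Hs. specialize (Hb s Hs). apply Rabs_le_between in Hb. lra.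
Qed.

(** The steps form an absolutely convergent series whose partial sums telescope to
    [u (S k) - u 0]. *)
Lemma geometric_steps_converge (u : nat -> R) (B : R) :
  (forall k, Rabs (u (S k) - u k) <= B * (/ 2) ^ k) -> ex_finite_lim_seq u.
Proof.
  intros H.
  assert (Hs : ex_series (fun k => u (S k) - u k)).
  { apply (ex_series_le (K := R_AbsRing) (V := R_CompleteNormedModule) _
      (fun k => B * (/ 2) ^ k)).
    - intros k. apply H.
    - apply (ex_series_scal (K := R_AbsRing) (V := R_NormedModule) B).
      apply ex_series_geom. rewrite Rabs_pos_eq; lra. }
  destruct Hs as [l Hl]. exists (u 0%nat + l).
  apply is_lim_seq_incr_1.
  apply (is_lim_seq_ext (fun k => u 0%nat + sum_n (fun k => u (S k) - u k) k)).
  - intros k. induction k as [|k IH].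
    + rewrite sum_O. ring.
    + rewrite sum_Sn. unfold plus; simpl. lra.
  - apply is_lim_seq_plus'; [apply is_lim_seq_const|exact Hl].
Qed.

Lemma is_lim_seq_rsum (n : nat) (g : nat -> nat -> R) (l : nat -> R) :
  (forall i, (i < n)%nat -> is_lim_seq (g i) (l i)) ->
  is_lim_seq (fun k => rsum n (fun i => g i k)) (rsum n l).
Proof.
  induction n as [|n IH]; intros H; simpl.
  - apply is_lim_seq_const.
  - apply is_lim_seq_plus'; [apply IH; intros; apply H|apply H]; lia.
Qed.

Fixpoint picard (F : vec -> vec) (p : vec) (k : nat) : R -> vec :=
  match k with
  | O => fun _ => p
  | S k => fun t i => p i + RInt (fun s => F (picard F p k s) i) 0 t
  end.

(** Holds for every index, also beyond the dimension, so that the limit curve starts at [p] as a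
    function and not just on the first [n] coordinates. *)
Lemma picard_0 (F : vec -> vec) (p : vec) (k i : nat) : picard F p k 0 i = p i.
Proof.
  destruct k; simpl; [reflexivity|]. rewrite RInt_point. unfold zero; simpl. ring.
Qed.

(** The invariant of the iteration is a Lipschitz bound in time: it makes the integrand Lipschitz,
    hence continuous and integrable, and the fundamental theorem of calculus applies. *)
Lemma is_derive_picard_step (n : nat) (F : vec -> vec) (L M : R) (p : vec) (y : R -> vec) (i : nat) :
  0 <= L ->
  (forall x y i, (i < n)%nat -> Rabs (F y i - F x i) <= L * norm n (vsub y x)) ->
  (forall i s t, (i < n)%nat -> Rabs (y s i - y t i) <= M * Rabs (s - t)) ->
  (i < n)%nat ->
  forall t, is_derive (fun t => p i + RInt (fun s => F (y s) i) 0 t) t (F (y t) i).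
Proof.
  intros HL HF Hy Hi t.
  assert (Hc : forall t, continuous (fun s => F (y s) i) t).
  { apply (lipschitz_continuous _ (L * (INR n * M))). intros s u.
    eapply Rle_trans; [now apply HF|]. rewrite !Rmult_assoc.
    apply Rmult_le_compat_l; [assumption|]. apply norm_le_const.
    intros j Hj. now apply Hy. }
  rewrite <- (Rplus_0_l (F (y t) i)).
  apply (is_derive_plus (fun _ => p i) (fun t => RInt (fun s => F (y s) i) 0 t)).
  - apply (is_derive_const (p i)).
  - apply (is_derive_RInt (fun s => F (y s) i) _ 0 t); [|apply Hc].
    exists (mkposreal 1 Rlt_0_1). intros u _. apply (RInt_correct (V := R_CompleteNormedModule)).
    apply (ex_RInt_continuous (V := R_CompleteNormedModule)). intros; apply Hc.
Qed.

(** That [y] solves the equation is expressed by a uniform quadratic error. Such an inequality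
    passes to the limit of the iterates pointwise, without exchanging limit and derivative. *)
Lemma bounded_lipschitz_flow (n : nat) (F : vec -> vec) (L M : R) (p : vec) :
  0 <= L -> 0 <= M ->
  (forall x i, (i < n)%nat -> Rabs (F x i) <= M) ->
  (forall x y i, (i < n)%nat -> Rabs (F y i - F x i) <= L * norm n (vsub y x)) ->
  exists y : R -> vec, y 0 = p /\
    (forall s t i, 0 <= s -> 0 <= t -> (i < n)%nat -> Rabs (y s i - y t i) <= M * Rabs (s - t)) /\
    (forall s t i, 0 <= s -> 0 <= t -> (i < n)%nat ->
       Rabs (y s i - y t i - (s - t) * F (y t) i) <= L * (INR n * M) * Rabs (s - t) * Rabs (s - t)).
Proof.
  intros HL HM HFM HFL.
  assert (Hlip : forall k i s t, (i < n)%nat ->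
     Rabs (picard F p k s i - picard F p k t i) <= M * Rabs (s - t)).
  { induction k as [|k IH]; intros i s t Hi.
    - simpl. rewrite Rminus_diag, Rabs_R0. apply Rmult_le_pos; [assumption|apply Rabs_pos].
    - apply (is_derive_lipschitz (fun t => picard F p (S k) t i) (fun t => F (picard F p k t) i)).
      + exact (is_derive_picard_step n F L M p (picard F p k) i HL HFL IH Hi).
      + intros; now apply HFM. }
  assert (Hder : forall k i t, (i < n)%nat ->
     is_derive (fun t => picard F p (S k) t i) t (F (picard F p k t) i)).
  { intros k i t Hi.
    exact (is_derive_picard_step n F L M p (picard F p k) i HL HFL (Hlip k) Hi t). }
  assert (Pn := pos_INR n).
  (* The induction step requires [L * INR n <= kappa / 2], the first iterate requires
     [1 <= kappa]. *)
  set (kappa := 2 * (L * INR n) + 1).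
  assert (HLn : 0 <= L * INR n) by now apply Rmult_le_pos.
  assert (Hk : 1 <= kappa) by (unfold kappa; lra).
  (* The weight [exp (kappa * t)] makes the iteration a contraction of ratio 1/2 for all times. *)
  assert (Hstep : forall k t i, 0 <= t -> (i < n)%nat ->
     Rabs (picard F p (S k) t i - picard F p k t i) <= M * (/ 2) ^ k * exp (kappa * t)).
  { induction k as [|k IH]; intros t i Ht Hi.
    - apply (exp_domination (fun t => picard F p 1 t i - p i) (fun t => F p i)); [| | |assumption].
      + intros s. rewrite <- (Rminus_0_r (F p i)).
        apply (is_derive_minus (fun s => picard F p 1 s i) (fun _ => p i) s (F p i) 0);
          [apply (Hder 0%nat); assumption|apply (is_derive_const (p i))].
      + rewrite picard_0, Rminus_diag, Rabs_R0. simpl. lra.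
      + intros s Hs. simpl. rewrite Rmult_1_r.
        eapply Rle_trans; [now apply HFM|].
        assert (1 <= exp (kappa * s)).
        { assert (Q := exp_ineq1_le (kappa * s)).
          assert (0 <= kappa * s) by (apply Rmult_le_pos; lra). lra. }
        assert (M * 1 <= M * (kappa * exp (kappa * s))) by (apply Rmult_le_compat_l; nra).
        lra.
    - apply (exp_domination (fun t => picard F p (S (S k)) t i - picard F p (S k) t i)
        (fun t => F (picard F p (S k) t) i - F (picard F p k t) i)); [| | |assumption].
      + intros s.
        apply (is_derive_minus (fun s => picard F p (S (S k)) s i) (fun s => picard F p (S k) s i));
          now apply Hder.
      + rewrite !picard_0, Rminus_diag, Rabs_R0.
        apply Rmult_le_pos; [assumption|]. apply pow_le; lra.
      + intros s Hs. eapply Rle_trans; [now apply HFL|].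
        eapply Rle_trans.
        * apply Rmult_le_compat_l; [assumption|]. apply norm_le_const.
          intros j Hj. exact (IH s j Hs Hj).
        * assert (0 <= M * (/ 2) ^ k * exp (kappa * s)).
          { apply Rmult_le_pos; [apply Rmult_le_pos; [assumption|apply pow_le; lra]|].
            apply Rlt_le, exp_pos. }
          simpl. unfold kappa at 2. nra. }
  set (y := fun t i => real (Lim_seq (fun k => picard F p k t i))).
  assert (Hlim : forall t i, 0 <= t -> (i < n)%nat ->
     is_lim_seq (fun k => picard F p k t i) (y t i)).
  { intros t i Ht Hi. apply Lim_seq_correct'.
    apply (geometric_steps_converge _ (M * exp (kappa * t))). intros k.
    eapply Rle_trans; [now apply Hstep|]. lra. }
  exists y. split; [|split].
  - apply functional_extensionality. intros i. unfold y.
    rewrite (Lim_seq_ext _ (fun _ => p i)) by (intros; apply picard_0).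
    now rewrite Lim_seq_const.
  - intros s t i Hs Ht Hi.
    apply (is_lim_seq_le (fun k => Rabs (picard F p k s i - picard F p k t i))
             (fun _ => M * Rabs (s - t)) (Rabs (y s i - y t i)) (M * Rabs (s - t))).
    + intros k. now apply Hlip.
    + apply (is_lim_seq_abs _ (y s i - y t i)).
      apply is_lim_seq_minus'; now apply Hlim.
    + apply is_lim_seq_const.
  - intros s t i Hs Ht Hi.
    (* By the mean value theorem the error of the next iterate is governed by [F] at the current
       one, whose distance to [y t] is the travel between times [t] and [s] plus [e k]; the latter
       vanishes in the limit. *)
    pose (e := fun k => rsum n (fun j => Rabs (picard F p k t j - y t j))).
    assert (He : is_lim_seq e 0).
    { replace 0 with (rsum n (fun _ => 0)) by (rewrite rsum_const; ring).
      unfold e. apply (is_lim_seq_rsum n (fun j k => Rabs (picard F p k t j - y t j))).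
      intros j Hj. rewrite <- Rabs_R0. apply (is_lim_seq_abs _ 0).
      rewrite <- (Rminus_diag (y t j)).
      apply is_lim_seq_minus'; [now apply Hlim|apply is_lim_seq_const]. }
    apply (is_lim_seq_le
      (fun k => Rabs (picard F p (S k) s i - picard F p (S k) t i - (s - t) * F (y t) i))
      (fun k => (L * (INR n * (M * Rabs (s - t)) + e k)) * Rabs (s - t))
      (Rabs (y s i - y t i - (s - t) * F (y t) i))
      (L * (INR n * M) * Rabs (s - t) * Rabs (s - t))).
    + intros k.
      destruct (MVT_gen (fun t => picard F p (S k) t i) t s (fun t => F (picard F p k t) i))
        as [c [Hc E]].
      * intros; now apply Hder.
      * intros x _. apply derivable_continuous_pt. eexists. apply is_derive_Reals. now apply Hder.
      * rewrite E.
        replace (F (picard F p k c) i * (s - t) - (s - t) * F (y t) i)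
          with ((F (picard F p k c) i - F (y t) i) * (s - t)) by ring.
        rewrite Rabs_mult. apply Rmult_le_compat_r; [apply Rabs_pos|].
        eapply Rle_trans; [now apply HFL|]. apply Rmult_le_compat_l; [assumption|].
        eapply Rle_trans; [apply (norm_vsub_triangle n _ (picard F p k t))|].
        apply Rplus_le_compat; [|apply norm_le_rsum].
        apply norm_le_const. intros j Hj. unfold vsub.
        eapply Rle_trans; [now apply Hlip|]. apply Rmult_le_compat_l; [assumption|].
        revert Hc. unfold Rmin, Rmax, Rabs.
        destruct (Rle_dec t s), (Rcase_abs (c - t)), (Rcase_abs (s - t)); lra.
    + apply (is_lim_seq_abs _ (y s i - y t i - (s - t) * F (y t) i)).
      apply is_lim_seq_minus'; [|apply is_lim_seq_const].
      apply is_lim_seq_minus'; apply (is_lim_seq_incr_1 (fun k => picard F p k _ i));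
        now apply Hlim.
    + replace (L * (INR n * M) * Rabs (s - t) * Rabs (s - t))
        with (L * (INR n * (M * Rabs (s - t)) + 0) * Rabs (s - t)) by ring.
      apply is_lim_seq_mult'; [|apply is_lim_seq_const].
      apply is_lim_seq_mult'; [apply is_lim_seq_const|].
      apply is_lim_seq_plus'; [apply is_lim_seq_const|exact He].
Qed.

(** * Derivatives within an interval *)

(** The derivative used in [is_sol], for one coordinate. At an end point of [I] it is one-sided, and
    the form without quotient also covers [s = t]. *)
Definition wderiv (I : R -> Prop) (g : R -> R) (t l : R) : Prop :=
  forall eps, 0 < eps -> exists d, 0 < d /\
    forall s, I s -> Rabs (s - t) < d -> Rabs (g s - g t - l * (s - t)) <= eps * Rabs (s - t).

Lemma wderiv_lipschitz (I : R -> Prop) (g : R -> R) (t l : R) : wderiv I g t l ->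
  exists d, 0 < d /\
    forall s, I s -> Rabs (s - t) < d -> Rabs (g s - g t) <= (Rabs l + 1) * Rabs (s - t).
Proof.
  intros H. destruct (H 1 Rlt_0_1) as [d [Hd Hb]]. exists d. split; [assumption|].
  intros s Is Hs. replace (g s - g t) with (l * (s - t) + (g s - g t - l * (s - t))) by ring.
  eapply Rle_trans; [apply Rabs_triang|]. rewrite Rabs_mult. specialize (Hb s Is Hs). lra.
Qed.

Lemma is_derive_wderiv (I : R -> Prop) (g : R -> R) (t l : R) :
  is_derive g t l -> wderiv I g t l.
Proof.
  intros H eps Heps. apply is_derive_Reals in H. destruct (H eps Heps) as [d Hd].
  exists d. split; [apply cond_pos|]. intros s _ Hs.
  destruct (Req_dec s t) as [->|Hst].
  - rewrite !Rminus_diag, Rmult_0_r, Rminus_0_r, Rabs_R0. lra.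
  - assert (Hn : s - t <> 0) by lra. specialize (Hd (s - t) Hn Hs).
    replace (t + (s - t)) with s in Hd by ring.
    replace (g s - g t - l * (s - t)) with (((g s - g t) / (s - t) - l) * (s - t)) by (field; lra).
    rewrite Rabs_mult. apply Rmult_le_compat_r; [apply Rabs_pos|lra].
Qed.

Lemma wderiv_plus (I : R -> Prop) (g h : R -> R) (t l k : R) :
  wderiv I g t l -> wderiv I h t k -> wderiv I (fun s => g s + h s) t (l + k).
Proof.
  intros Hg Hh eps Heps.
  destruct (Hg (eps / 2) ltac:(lra)) as [d [Hd Bg]].
  destruct (Hh (eps / 2) ltac:(lra)) as [e [He Bh]].
  exists (Rmin d e). split; [now apply Rmin_pos|]. intros s Is Hs.
  assert (A := Rmin_l d e). assert (B := Rmin_r d e).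
  specialize (Bg s Is ltac:(lra)). specialize (Bh s Is ltac:(lra)).
  replace (g s + h s - (g t + h t) - (l + k) * (s - t))
    with ((g s - g t - l * (s - t)) + (h s - h t - k * (s - t))) by ring.
  eapply Rle_trans; [apply Rabs_triang|]. lra.
Qed.

Lemma wderiv_minus (I : R -> Prop) (g h : R -> R) (t l k : R) :
  wderiv I g t l -> wderiv I h t k -> wderiv I (fun s => g s - h s) t (l - k).
Proof.
  intros Hg Hh eps Heps.
  destruct (Hg (eps / 2) ltac:(lra)) as [d [Hd Bg]].
  destruct (Hh (eps / 2) ltac:(lra)) as [e [He Bh]].
  exists (Rmin d e). split; [now apply Rmin_pos|]. intros s Is Hs.
  assert (A := Rmin_l d e). assert (B := Rmin_r d e).
  specialize (Bg s Is ltac:(lra)). specialize (Bh s Is ltac:(lra)).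
  replace (g s - h s - (g t - h t) - (l - k) * (s - t))
    with ((g s - g t - l * (s - t)) - (h s - h t - k * (s - t))) by ring.
  eapply Rle_trans; [apply Rabs_triang|]. rewrite Rabs_Ropp. lra.
Qed.

Lemma wderiv_mult (I : R -> Prop) (g h : R -> R) (t l k : R) :
  wderiv I g t l -> wderiv I h t k -> wderiv I (fun s => g s * h s) t (l * h t + g t * k).
Proof.
  intros Hg Hh eps Heps.
  assert (Pg := Rabs_pos (g t)). assert (Ph := Rabs_pos (h t)).
  assert (Pl := Rabs_pos l). assert (Pk := Rabs_pos k).
  destruct (wderiv_lipschitz I g t l Hg) as [d1 [Hd1 B1]].
  destruct (wderiv_lipschitz I h t k Hh) as [d2 [Hd2 B2]].
  destruct (Hg (eps / (3 * (Rabs (h t) + 1)))) as [d3 [Hd3 B3]];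
    [apply Rdiv_lt_0_compat; lra|].
  destruct (Hh (eps / (3 * (Rabs (g t) + 1)))) as [d4 [Hd4 B4]];
    [apply Rdiv_lt_0_compat; lra|].
  set (Q := (Rabs l + 1) * (Rabs k + 1)).
  assert (HQ : 0 < Q) by (apply Rmult_lt_0_compat; lra).
  (* The product of the two increments is at most [Q * |s - t|^2]; within this radius it is at most
     a third of [eps * |s - t|]. *)
  set (d5 := eps / (3 * Q)).
  assert (Hd5 : 0 < d5) by (apply Rdiv_lt_0_compat; lra).
  exists (Rmin d1 (Rmin d2 (Rmin d3 (Rmin d4 d5)))).
  split; [repeat apply Rmin_pos; assumption|]. intros s Is Hs.
  assert (A1 := Rmin_l d1 (Rmin d2 (Rmin d3 (Rmin d4 d5)))).
  assert (A1' := Rmin_r d1 (Rmin d2 (Rmin d3 (Rmin d4 d5)))).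
  assert (A2 := Rmin_l d2 (Rmin d3 (Rmin d4 d5))).
  assert (A2' := Rmin_r d2 (Rmin d3 (Rmin d4 d5))).
  assert (A3 := Rmin_l d3 (Rmin d4 d5)). assert (A3' := Rmin_r d3 (Rmin d4 d5)).
  assert (A4 := Rmin_l d4 d5). assert (A4' := Rmin_r d4 d5).
  specialize (B1 s Is ltac:(lra)). specialize (B2 s Is ltac:(lra)).
  specialize (B3 s Is ltac:(lra)). specialize (B4 s Is ltac:(lra)).
  assert (P := Rabs_pos (s - t)).
  replace (g s * h s - g t * h t - (l * h t + g t * k) * (s - t))
    with (h t * (g s - g t - l * (s - t)) + g t * (h s - h t - k * (s - t))
          + (g s - g t) * (h s - h t)) by ring.
  eapply Rle_trans; [apply Rabs_triang|].
  eapply Rle_trans; [apply Rplus_le_compat_r, Rabs_triang|]. rewrite !Rabs_mult.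
  assert (aux : forall a x, 0 <= a -> x <= eps / (3 * (a + 1)) * Rabs (s - t) ->
     a * x <= eps / 3 * Rabs (s - t)).
  { intros a x Ha Hx. apply (Rmult_le_compat_l a) in Hx; [|assumption].
    eapply Rle_trans; [exact Hx|].
    replace (eps / 3 * Rabs (s - t))
      with ((a + 1) * (eps / (3 * (a + 1)) * Rabs (s - t))) by (field; lra).
    apply Rmult_le_compat_r; [|lra]. apply Rmult_le_pos; [|assumption].
    apply Rlt_le, Rdiv_lt_0_compat; lra. }
  assert (C1 := aux _ _ Ph B3). assert (C2 := aux _ _ Pg B4).
  assert (C3 : Rabs (g s - g t) * Rabs (h s - h t) <= eps / 3 * Rabs (s - t)).
  { eapply Rle_trans; [apply Rmult_le_compat; try apply Rabs_pos; [exact B1|exact B2]|].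
    replace ((Rabs l + 1) * Rabs (s - t) * ((Rabs k + 1) * Rabs (s - t)))
      with (Q * Rabs (s - t) * Rabs (s - t)) by (unfold Q; ring).
    apply Rmult_le_compat_r; [assumption|].
    replace (eps / 3) with (Q * d5) by (unfold d5; field; lra).
    apply Rmult_le_compat_l; lra. }
  lra.
Qed.

Lemma wderiv_rsum (n : nat) (I : R -> Prop) (g : nat -> R -> R) (t : R) (l : nat -> R) :
  (forall i, (i < n)%nat -> wderiv I (g i) t (l i)) ->
  wderiv I (fun s => rsum n (fun i => g i s)) t (rsum n l).
Proof.
  induction n as [|n IH]; intros H; simpl.
  - apply is_derive_wderiv, (is_derive_const 0).
  - apply (wderiv_plus I (fun s => rsum n (fun i => g i s)) (g n));
      [apply IH; intros; apply H|apply H]; lia.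
Qed.

(** Composing [g] with the projection onto [[a, b]] gives a function on the whole line that is
    continuous at the end points and unchanged inside, so the two-sided mean value theorem applies
    to it. *)
Lemma wderiv_MVT (I : R -> Prop) (g l : R -> R) (a b : R) :
  a <= b -> (forall t, a <= t <= b -> I t) ->
  (forall t, a <= t <= b -> wderiv I g t (l t)) ->
  exists c, a <= c <= b /\ g b - g a = l c * (b - a).
Proof.
  intros Hab HI Hg. destruct (Req_dec a b) as [<-|Hne].
  { exists a. split; [lra|ring]. }
  set (clamp := fun s => Rmax a (Rmin b s)).
  assert (Hin : forall s, a <= clamp s <= b).
  { intros s. unfold clamp, Rmax, Rmin. destruct (Rle_dec b s); destruct (Rle_dec a _); lra. }
  assert (Hid : forall s, a <= s <= b -> clamp s = s).
  { intros s Hs. unfold clamp. rewrite Rmin_right, Rmax_right by lra. reflexivity. }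
  assert (Hcon : forall s t, a <= t <= b -> Rabs (clamp s - t) <= Rabs (s - t)).
  { intros s t Ht. unfold clamp, Rmax, Rmin, Rabs.
    destruct (Rle_dec b s); destruct (Rle_dec a _);
      repeat destruct (Rcase_abs _); lra. }
  destruct (MVT_gen (fun s => g (clamp s)) a b l) as [c [Hc E]].
  - rewrite Rmin_left, Rmax_right by lra. intros x Hx.
    apply is_derive_Reals. intros eps Heps.
    destruct (Hg x ltac:(lra) (eps / 2) ltac:(lra)) as [d [Hd Hb]].
    assert (Hdel : 0 < Rmin d (Rmin (x - a) (b - x))) by (repeat apply Rmin_pos; lra).
    exists (mkposreal _ Hdel). simpl. intros h Hh Hhd.
    assert (A1 := Rmin_l d (Rmin (x - a) (b - x))).
    assert (A1' := Rmin_r d (Rmin (x - a) (b - x))).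
    assert (A2 := Rmin_l (x - a) (b - x)). assert (A2' := Rmin_r (x - a) (b - x)).
    assert (Hh' : - (Rmin d (Rmin (x - a) (b - x))) < h < Rmin d (Rmin (x - a) (b - x))).
    { apply Rabs_def2 in Hhd. lra. }
    rewrite !Hid by lra.
    specialize (Hb (x + h) (HI (x + h) ltac:(lra))).
    replace (x + h - x) with h in Hb by ring. specialize (Hb ltac:(lra)).
    replace ((g (x + h) - g x) / h - l x) with ((g (x + h) - g x - l x * h) * / h)
      by (field; assumption).
    rewrite Rabs_mult, Rabs_inv. assert (Ph := Rabs_pos_lt h Hh).
    apply (Rmult_lt_reg_r (Rabs h)); [assumption|].
    rewrite Rmult_assoc, Rinv_l, Rmult_1_r by lra. nra.
  - rewrite Rmin_left, Rmax_right by lra. intros x Hx eps Heps.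
    destruct (wderiv_lipschitz I g x (l x) (Hg x Hx)) as [d [Hd Hb]].
    assert (Pl := Rabs_pos (l x)).
    assert (He : 0 < eps / (Rabs (l x) + 1)) by (apply Rdiv_lt_0_compat; lra).
    exists (Rmin d (eps / (Rabs (l x) + 1))). split; [now apply Rmin_pos|].
    intros s [_ Hs]. simpl in *. unfold R_dist in *. rewrite (Hid x Hx).
    assert (A := Rmin_l d (eps / (Rabs (l x) + 1))).
    assert (B := Rmin_r d (eps / (Rabs (l x) + 1))).
    assert (Q := Hcon s x Hx).
    eapply Rle_lt_trans; [apply Hb; [apply HI, Hin|lra]|].
    replace eps with ((Rabs (l x) + 1) * (eps / (Rabs (l x) + 1))) at 1 by (field; lra).
    apply Rmult_lt_compat_l; lra.
  - rewrite Rmin_left, Rmax_right in Hc by lra.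
    rewrite !Hid in E by lra. now exists c.
Qed.

(** * Solutions: chain rule, dissipation, uniqueness *)

Lemma is_sol_coord (n : nat) (F : vec -> vec) (W : vset) (I : R -> Prop) (y : R -> vec)
  (t : R) (i : nat) :
  is_sol n F W I y -> I t -> (i < n)%nat -> wderiv I (fun s => y s i) t (F (y t) i).
Proof.
  intros H It Hi eps Heps. destruct (proj2 (H t It) eps Heps) as [d [Hd Hb]].
  exists d. split; [assumption|]. intros s Is Hs. specialize (Hb s Is Hs).
  eapply Rle_trans; [|exact Hb].
  rewrite (Rmult_comm (F (y t) i)). exact (Rabs_coord_le_norm n _ i Hi).
Qed.

Lemma dot_plus_r (n : nat) (u v w : vec) : dot n u (vadd v w) = dot n u v + dot n u w.
Proof.
  unfold dot. rewrite <- rsum_plus. apply rsum_ext. intros; unfold vadd; ring.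
Qed.

Lemma dot_scal_r (n : nat) (a : R) (u v : vec) : dot n u (vscal a v) = a * dot n u v.
Proof.
  unfold dot. rewrite <- rsum_scal. apply rsum_ext. intros; unfold vscal; ring.
Qed.

Lemma is_sol_chain (n : nat) (F : vec -> vec) (W : vset) (I : R -> Prop) (y : R -> vec)
  (V : vec -> R) (g : vec) (t : R) :
  is_sol n F W I y -> I t -> is_gradient n V (y t) g ->
  wderiv I (fun s => V (y s)) t (dot n g (F (y t))).
Proof.
  intros Hsol It HV eps Heps.
  set (v := F (y t)). assert (Pv := norm_nonneg n v). assert (Pg := norm_nonneg n g).
  destruct (HV (eps / (2 * (norm n v + 1)))) as [d1 [Hd1 B1]];
    [apply Rdiv_lt_0_compat; lra|].
  (* The bound 1 keeps the increment [h] of [y] below [(norm n v + 1) * |s - t|]; the other bound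
     makes the pairing of [g] with the remainder [q] at most [eps / 2 * |s - t|]. *)
  set (e2 := Rmin 1 (eps / (2 * (norm n g + 1)))).
  assert (He2 : 0 < e2) by (apply Rmin_pos; [lra|apply Rdiv_lt_0_compat; lra]).
  assert (He2' : e2 <= 1) by apply Rmin_l.
  assert (He2'' : norm n g * e2 <= eps / 2).
  { assert (Q : e2 <= eps / (2 * (norm n g + 1))) by apply Rmin_r.
    replace (eps / 2) with ((norm n g + 1) * (eps / (2 * (norm n g + 1)))) by (field; lra).
    nra. }
  destruct (proj2 (Hsol t It) e2 He2) as [d2 [Hd2 B2]].
  assert (Hd3 : 0 < d1 / (norm n v + 1)) by (apply Rdiv_lt_0_compat; lra).
  exists (Rmin d2 (d1 / (norm n v + 1))). split; [now apply Rmin_pos|].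
  intros s Is Hs.
  assert (A := Rmin_l d2 (d1 / (norm n v + 1))). assert (A' := Rmin_r d2 (d1 / (norm n v + 1))).
  specialize (B2 s Is ltac:(lra)). fold v in B2.
  set (h := vsub (y s) (y t)) in *. set (q := vsub h (vscal (s - t) v)) in *.
  assert (Eh : h = vadd (vscal (s - t) v) q)
    by (apply functional_extensionality; intros k; unfold q, vsub, vadd, vscal; ring).
  assert (P := Rabs_pos (s - t)).
  assert (Hh : norm n h <= (norm n v + 1) * Rabs (s - t)).
  { rewrite Eh. eapply Rle_trans; [apply norm_vadd|]. rewrite norm_vscal. nra. }
  assert (Hhd : norm n h < d1).
  { eapply Rle_lt_trans; [exact Hh|].
    replace d1 with ((norm n v + 1) * (d1 / (norm n v + 1))) by (field; lra).
    apply Rmult_lt_compat_l; lra. }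
  specialize (B1 h Hhd).
  eapply Rle_trans in B1; [|apply (Rabs_coord_le_norm 1 _ 0%nat Nat.lt_0_1)].
  replace (vadd (y t) h) with (y s) in B1
    by (apply functional_extensionality; intros k; unfold h, vadd, vsub; ring).
  change (Rabs (V (y s) - V (y t) - dot n g h)
          <= eps / (2 * (norm n v + 1)) * norm n h) in B1.
  assert (Eg : dot n g h = dot n g v * (s - t) + dot n g q).
  { rewrite Eh at 1. rewrite dot_plus_r, dot_scal_r. ring. }
  replace (V (y s) - V (y t) - dot n g v * (s - t))
    with ((V (y s) - V (y t) - dot n g h) + dot n g q) by (rewrite Eg; ring).
  eapply Rle_trans; [apply Rabs_triang|].
  assert (T1 : eps / (2 * (norm n v + 1)) * norm n h <= eps / 2 * Rabs (s - t)).
  { replace (eps / 2 * Rabs (s - t))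
      with (eps / (2 * (norm n v + 1)) * ((norm n v + 1) * Rabs (s - t))) by (field; lra).
    apply Rmult_le_compat_l; [|assumption]. apply Rlt_le, Rdiv_lt_0_compat; lra. }
  assert (T2 : Rabs (dot n g q) <= eps / 2 * Rabs (s - t)).
  { eapply Rle_trans; [apply dot_le_norm|].
    eapply Rle_trans; [apply Rmult_le_compat_l; [assumption|exact B2]|].
    rewrite <- Rmult_assoc. now apply Rmult_le_compat_r. }
  lra.
Qed.

(** The lower bound [kap] is 0 when only monotonicity of [V] along the solution is wanted, and
    positive when [V] has to drop at a definite rate. *)
Lemma is_sol_dissipation (n : nat) (X gV : vec -> vec) (V : vec -> R) (W : vset)
  (I : R -> Prop) (y : R -> vec) (a b kap : R) :
  (forall x, W x -> is_gradient n V x (gV x)) ->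
  (forall x, W x -> dot n (gV x) (X x) = 0) ->
  is_sol n (fun x => vsub (X x) (gV x)) W I y ->
  a <= b -> (forall t, a <= t <= b -> I t) ->
  (forall t, a <= t <= b -> kap <= dot n (gV (y t)) (gV (y t))) ->
  V (y b) <= V (y a) - kap * (b - a).
Proof.
  intros HV HX Hsol Hab HI Hk.
  destruct (wderiv_MVT I (fun t => V (y t))
    (fun t => dot n (gV (y t)) (vsub (X (y t)) (gV (y t)))) a b Hab HI) as [c [Hc E]].
  - intros t Ht. apply (is_sol_chain n (fun x => vsub (X x) (gV x)) W).
    + assumption.
    + now apply HI.
    + apply HV. exact (proj1 (Hsol t (HI t Ht))).
  - assert (Q : dot n (gV (y c)) (vsub (X (y c)) (gV (y c))) <= - kap).
    { unfold dot, vsub.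
      rewrite (rsum_ext n _ (fun i => gV (y c) i * X (y c) i - gV (y c) i * gV (y c) i))
        by (intros; ring).
      rewrite rsum_minus. specialize (Hk c Hc).
      specialize (HX (y c) (proj1 (Hsol c (HI c Hc)))). unfold dot in *. lra. }
    apply (Rmult_le_compat_r (b - a)) in Q; [|lra]. lra.
Qed.

(** Gronwall in multiplied form: the squared distance times [exp (- kappa * s)] vanishes at 0 and
    has nonpositive derivative. Each of the [n] coordinates contributes at most [2 * L] times the
    squared distance, whence [kappa]. *)
Lemma is_sol_unique (n : nat) (F : vec -> vec) (W : vset) (L T : R) (y z : R -> vec) :
  (forall u v i, W u -> W v -> (i < n)%nat -> Rabs (F v i - F u i) <= L * norm n (vsub v u)) ->
  is_sol n F W (fun t => 0 <= t < T) y -> is_sol n F W (fun t => 0 <= t < T) z ->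
  y 0 = z 0 ->
  forall t i, 0 <= t < T -> (i < n)%nat -> y t i = z t i.
Proof.
  intros HF Hy Hz H0 t i Ht Hi.
  set (I := fun t => 0 <= t < T) in *.
  set (kappa := 2 * (L * INR n)).
  set (d := fun s => vsub (y s) (z s)).
  set (d' := fun s => vsub (F (y s)) (F (z s))).
  assert (HI : forall s, 0 <= s <= t -> I s) by (intros s Hs; unfold I; lra).
  assert (Hd : forall s j, I s -> (j < n)%nat -> wderiv I (fun s => d s j) s (d' s j)).
  { intros s j Is Hj.
    apply (wderiv_minus I (fun s => y s j) (fun s => z s j));
      now apply (is_sol_coord n F W). }
  destruct (wderiv_MVT I (fun s => dot n (d s) (d s) * exp (- kappa * s))
    (fun s => rsum n (fun j => d' s j * d s j + d s j * d' s j) * exp (- kappa * s)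
       + dot n (d s) (d s) * (- kappa * exp (- kappa * s))) 0 t ltac:(lra) HI) as [c [Hc E]].
  { intros s Hs.
    apply (wderiv_mult I (fun s => dot n (d s) (d s)) (fun s => exp (- kappa * s))).
    - unfold dot. apply wderiv_rsum. intros j Hj.
      apply (wderiv_mult I (fun s => d s j) (fun s => d s j)); apply Hd; auto.
    - apply is_derive_wderiv. auto_derive; [trivial|ring]. }
  assert (Hn0 : dot n (d 0) (d 0) = 0).
  { rewrite <- norm_sqr. unfold d. rewrite H0, norm_vsub_diag. ring. }
  rewrite Hn0 in E.
  assert (Hgr : rsum n (fun j => d' c j * d c j + d c j * d' c j) <= kappa * dot n (d c) (d c)).
  { assert (Wy := proj1 (Hy c (HI c Hc))). assert (Wz := proj1 (Hz c (HI c Hc))).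
    replace (kappa * dot n (d c) (d c))
      with (rsum n (fun _ => 2 * (L * (norm n (d c) * norm n (d c)))))
      by (rewrite rsum_const, norm_sqr; unfold kappa; ring).
    apply rsum_le. intros j Hj.
    assert (Q := HF (z c) (y c) j Wz Wy Hj). fold (d c) in Q.
    assert (Q' := Rabs_coord_le_norm n (d c) j Hj).
    assert (Q'' : Rabs (d' c j * d c j) <= L * norm n (d c) * norm n (d c)).
    { rewrite Rabs_mult. apply Rmult_le_compat; try apply Rabs_pos; assumption. }
    apply Rabs_le_between in Q''. lra. }
  assert (Pe := exp_pos (- kappa * c)). assert (Pe' := exp_pos (- kappa * t)).
  assert (Hle : dot n (d t) (d t) * exp (- kappa * t) <= 0).
  { assert (Q := Rmult_le_compat_r _ _ _ (Rlt_le _ _ Pe) Hgr).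
    assert (Q' : (rsum n (fun j => d' c j * d c j + d c j * d' c j) * exp (- kappa * c)
       + dot n (d c) (d c) * (- kappa * exp (- kappa * c))) * (t - 0) <= 0 * (t - 0))
      by (apply Rmult_le_compat_r; lra).
    lra. }
  assert (Pd := dot_nonneg n (d t)).
  assert (Hdt : dot n (d t) (d t) = 0) by nra.
  assert (Hnt : norm n (d t) = 0) by (unfold norm; rewrite Hdt; apply sqrt_0).
  assert (Q := norm_0_coord n (d t) i Hnt Hi). unfold d, vsub in Q. lra.
Qed.

(** [G] is the extended field that produced the curve; as long as the curve stays in [W] it can be
    traded for [F]. *)
Lemma is_sol_of_quadratic_error (n : nat) (F G : vec -> vec) (W : vset) (I : R -> Prop)
  (y : R -> vec) (B : R) :
  0 <= B -> (forall t, I t -> W (y t)) ->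
  (forall x i, W x -> (i < n)%nat -> G x i = F x i) ->
  (forall s t i, I s -> I t -> (i < n)%nat ->
     Rabs (y s i - y t i - (s - t) * G (y t) i) <= B * Rabs (s - t) * Rabs (s - t)) ->
  is_sol n F W I y.
Proof.
  intros HB HW HG Hq t It. split; [now apply HW|]. intros eps Heps.
  assert (Pn := pos_INR n). assert (PB : 0 <= INR n * B) by now apply Rmult_le_pos.
  exists (eps / (INR n * B + 1)). split; [apply Rdiv_lt_0_compat; lra|].
  intros s Is Hs. assert (P := Rabs_pos (s - t)).
  eapply Rle_trans.
  - apply (norm_le_const n _ (B * Rabs (s - t) * Rabs (s - t))). intros i Hi.
    unfold vsub, vscal. rewrite <- (HG (y t) i) by auto. now apply Hq.
  - rewrite <- !Rmult_assoc. apply Rmult_le_compat_r; [assumption|].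
    replace eps with ((INR n * B + 1) * (eps / (INR n * B + 1))) by (field; lra).
    assert (0 < eps / (INR n * B + 1)) by (apply Rdiv_lt_0_compat; lra). nra.
Qed.

(** * The sublevel flow *)

Lemma Lyap_nonneg (m : nat) (K : mat) (f : vec -> vec) (x0 x : vec) :
  posdef m K -> 0 <= Lyap m K f x0 x.
Proof.
  intros HK. unfold Lyap. set (d := vsub (f x) (f x0)).
  destruct (excluded_middle_informative (exists i, (i < m)%nat /\ d i <> 0)) as [H|H].
  - specialize (HK d H). lra.
  - unfold dot. rewrite (rsum_ext m _ (fun _ => 0)), rsum_const; [lra|].
    intros i Hi. destruct (Req_dec (d i) 0) as [->|Hd]; [ring|].
    exfalso. apply H. now exists i.
Qed.

Lemma loc_lip_Lyap (n m : nat) (K : mat) (f : vec -> vec) (x0 z : vec) :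
  (forall i, (i < m)%nat -> loc_lip n (fun x => f x i) z) -> loc_lip n (Lyap m K f x0) z.
Proof.
  intros Hf.
  assert (Hd : forall i, (i < m)%nat -> loc_lip n (fun x => vsub (f x) (f x0) i) z).
  { intros i Hi. apply (loc_lip_plus n (fun x => f x i) (fun _ => - f x0 i));
      [now apply Hf|apply loc_lip_const]. }
  unfold Lyap, dot, mulmv. apply loc_lip_mult; [apply loc_lip_const|].
  apply loc_lip_rsum. intros i Hi. apply loc_lip_mult; [now apply Hd|].
  apply loc_lip_rsum. intros j Hj. apply loc_lip_mult; [apply loc_lip_const|now apply Hd].
Qed.

(** Testing the gradient formula on the [j]-th unit vector writes [gV x j] near [z] as a sum of
    products of locally Lipschitz functions. *)
Lemma loc_lip_Lyap_gradient (n m : nat) (K : mat) (f : vec -> vec) (Df : vec -> mat)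
  (x0 : vec) (gV : vec -> vec) (z : vec) (j : nat) :
  symmetric m K ->
  near n z (fun x => has_deriv_at n m f x (Df x) /\ is_gradient n (Lyap m K f x0) x (gV x)) ->
  (forall i, (i < m)%nat -> loc_lip n (fun x => f x i) z) ->
  (forall i j, (i < m)%nat -> (j < n)%nat -> loc_lip n (fun x => Df x i j) z) ->
  (j < n)%nat -> loc_lip n (fun x => gV x j) z.
Proof.
  intros HK Hder Hf HDf Hj.
  apply (loc_lip_congr n (fun x => rsum m (fun i => Df x i j *
    rsum m (fun k => K i k * (f x k + - f x0 k))))).
  - eapply near_impl; [|exact Hder]. intros x [Hfx HVx].
    assert (E := Lyap_gradient n m K f x0 x (Df x) (gV x)
      (fun k => if Nat.eq_dec k j then 1 else 0) HK Hfx HVx).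
    unfold dot in E at 1. rewrite rsum_delta in E by assumption. rewrite E.
    unfold dot. apply rsum_ext. intros i Hi. unfold mulmv at 1.
    rewrite rsum_delta by assumption. reflexivity.
  - apply loc_lip_rsum. intros i Hi. apply loc_lip_mult; [now apply HDf|].
    apply loc_lip_rsum. intros k Hk. apply loc_lip_mult; [apply loc_lip_const|].
    apply loc_lip_plus; [now apply Hf|apply loc_lip_const].
Qed.

(** * One constant for all local estimates *)

Definition monotone_bound (Q : vec -> R -> Prop) : Prop :=
  forall x C C', C <= C' -> Q x C -> Q x C'.

Lemma near_bound_and (n : nat) (z : vec) (P Q : vec -> R -> Prop) :
  monotone_bound P -> monotone_bound Q ->
  (exists C, near n z (fun x => P x C)) -> (exists C, near n z (fun x => Q x C)) ->
  exists C, near n z (fun x => P x C /\ Q x C).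
Proof.
  intros MP MQ [C HC] [C' HC']. exists (Rmax C C').
  apply near_and; [apply (near_impl n z (fun x => P x C))|apply (near_impl n z (fun x => Q x C'))];
    try assumption; intros x; [apply MP, Rmax_l|apply MQ, Rmax_r].
Qed.

Lemma near_bound_forall_lt (n m : nat) (z : vec) (Q : nat -> vec -> R -> Prop) :
  (forall i, monotone_bound (Q i)) ->
  (forall i, (i < m)%nat -> exists C, near n z (fun x => Q i x C)) ->
  exists C, near n z (fun x => forall i, (i < m)%nat -> Q i x C).
Proof.
  intros MQ. induction m as [|m IH]; intros H.
  - exists 0, 1. split; [lra|intros; lia].
  - destruct (near_bound_and n z (fun x C => forall i, (i < m)%nat -> Q i x C) (Q m)) as [C HC].
    + intros x C C' HC HQ i Hi. apply (MQ i x C); auto.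
    + apply MQ.
    + apply IH. intros; apply H; lia.
    + apply H; lia.
    + exists C. eapply near_impl; [|exact HC]. intros x [H1 H2] i Hi.
      destruct (Nat.eq_dec i m) as [->|]; [assumption|apply H1; lia].
Qed.

Lemma monotone_bound_forall_lt (m : nat) (Q : nat -> vec -> R -> Prop) :
  (forall i, monotone_bound (Q i)) ->
  monotone_bound (fun x C => forall i, (i < m)%nat -> Q i x C).
Proof. intros MQ x C C' HC HQ i Hi. apply (MQ i x C); auto. Qed.

Lemma monotone_bound_and (P Q : vec -> R -> Prop) :
  monotone_bound P -> monotone_bound Q -> monotone_bound (fun x C => P x C /\ Q x C).
Proof. intros MP MQ x C C' HC [HP HQ]. split; [apply (MP x C)|apply (MQ x C)]; auto. Qed.

(** Writing the radius as [/ C] lets the same constant govern size and scale: a larger [C] shrinks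
    the ball and so weakens the claim. *)
Lemma monotone_bound_ball (n : nat) (Q : vec -> vec -> R -> Prop) :
  (forall y, monotone_bound (Q y)) ->
  monotone_bound (fun x C => 0 < C /\ forall y, norm n (vsub y x) < / C -> Q y x C).
Proof.
  intros MQ x C C' HC [H0 H]. split; [lra|]. intros y Hy.
  apply (MQ y x C); [assumption|]. apply H. eapply Rlt_le_trans; [exact Hy|].
  now apply Rinv_le_contravar.
Qed.

(** Moves the centre from [z] to a nearby [x]: the ball of radius [d / 2] around [x] lies in the
    [d]-ball around [z]. Adding [/ (d / 2)] to the constant brings its reciprocal below [d / 2]. *)
Lemma loc_lip_ball (n : nat) (g : vec -> R) (z : vec) : loc_lip n g z ->
  exists C, near n z (fun x => 0 < C /\ forall y, norm n (vsub y x) < / C ->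
    Rabs (g y - g x) <= C * norm n (vsub y x)).
Proof.
  intros [C [HC [d [Hd H]]]]. assert (Hd' : 0 < / (d / 2)) by (apply Rinv_0_lt_compat; lra).
  exists (C + / (d / 2)), (d / 2). split; [lra|]. intros x Hx. split; [lra|]. intros y Hy.
  assert (Hinv : / (C + / (d / 2)) <= d / 2).
  { rewrite <- (Rinv_inv (d / 2)) at 2. apply Rinv_le_contravar; lra. }
  assert (T := norm_vsub_triangle n y x z).
  eapply Rle_trans; [apply H; lra|]. apply Rmult_le_compat_r; [apply norm_nonneg|lra].
Qed.

Lemma loc_lip_coord (n : nat) (z : vec) (i : nat) :
  (i < n)%nat -> loc_lip n (fun x => x i) z.
Proof.
  intros Hi. exists 1. split; [lra|]. exists 1. split; [lra|]. intros x y _ _.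
  rewrite Rmult_1_l. exact (Rabs_coord_le_norm n (vsub y x) i Hi).
Qed.

(** A segment between points of [W] may leave [W], so local estimates cannot be chained. Points at
    distance at least [/ C] are handled by the sup bound: [2 C <= 2 C^2 |y - x|]. *)
Lemma lipschitz_of_local (n : nat) (W : vset) (g : vec -> R) (C : R) :
  0 < C -> (forall x, W x -> Rabs (g x) <= C) ->
  (forall x y, W x -> norm n (vsub y x) < / C -> Rabs (g y - g x) <= C * norm n (vsub y x)) ->
  forall x y, W x -> W y -> Rabs (g y - g x) <= (C + 2 * C * C) * norm n (vsub y x).
Proof.
  intros HC Hb Hl x y Wx Wy. assert (P := norm_nonneg n (vsub y x)).
  assert (PC : 0 < C * C) by now apply Rmult_lt_0_compat.
  destruct (Rlt_dec (norm n (vsub y x)) (/ C)) as [H|H].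
  - eapply Rle_trans; [now apply Hl|]. apply Rmult_le_compat_r; lra.
  - unfold Rminus. eapply Rle_trans; [apply Rabs_triang|]. rewrite Rabs_Ropp.
    assert (Bx := Hb x Wx). assert (By := Hb y Wy).
    assert (Q : 2 * C * C * / C <= 2 * C * C * norm n (vsub y x))
      by (apply Rmult_le_compat_l; lra).
    replace (2 * C * C * / C) with (2 * C) in Q by (field; lra).
    assert (0 <= C * norm n (vsub y x)) by (apply Rmult_le_pos; lra). lra.
Qed.

Lemma lipschitz_field_extension (n : nat) (W : vset) (F : vec -> vec) (L M : R) :
  (exists x, W x) -> 0 <= L ->
  (forall x i, W x -> (i < n)%nat -> Rabs (F x i) <= M) ->
  (forall x y i, W x -> W y -> (i < n)%nat -> Rabs (F y i - F x i) <= L * norm n (vsub y x)) ->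
  exists G : vec -> vec,
    (forall x i, W x -> (i < n)%nat -> G x i = F x i) /\
    (forall x i, (i < n)%nat -> Rabs (G x i) <= M) /\
    (forall x y i, (i < n)%nat -> Rabs (G y i - G x i) <= L * norm n (vsub y x)).
Proof.
  intros HW HL HM HF.
  destruct (functional_choice_on nat (vec -> R) (fun i G => (i < n)%nat ->
    (forall x, W x -> G x = F x i) /\ (forall x, Rabs (G x) <= M) /\
    (forall x y, Rabs (G y - G x) <= L * norm n (vsub y x)))) as [G HG].
  - intros i. destruct (Nat.lt_ge_cases i n) as [Hi|Hi].
    + destruct (lipschitz_extension n W (fun x => F x i) L M HW HL) as [G HG]; auto.
      now exists G.
    + exists (fun _ => 0). lia.
  - exists (fun x i => G i x). repeat split; intros; now apply HG.
Qed.

Lemma is_sol_weaken (n : nat) (F : vec -> vec) (W : vset) (I J : R -> Prop) (y : R -> vec) :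
  (forall t, J t -> I t) -> is_sol n F W I y -> is_sol n F W J y.
Proof.
  intros HJ H t Jt. destruct (H t (HJ t Jt)) as [HW Hd]. split; [assumption|].
  intros eps Heps. destruct (Hd eps Heps) as [d [Hd0 Hb]]. exists d. auto.
Qed.

(* While a solution stays in [W] the function [V] decreases, which confines it to the
   [r/2]-neighbourhood of the zero set; bounded speed then keeps it in [W] for a further time
   [delta] independent of the starting point. *)
Lemma sublevel_flow_exists (n : nat) (X gV : vec -> vec) (V : vec -> R) (Z W : vset)
  (r c L M : R) :
  0 < r -> 0 <= L -> 0 <= M ->
  (forall x, W x <-> exists z, Z z /\ norm n (vsub x z) < r) ->
  (forall x, W x -> V x <= c -> exists z, Z z /\ norm n (vsub x z) < r / 2) ->
  (forall x, W x -> is_gradient n V x (gV x)) ->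
  (forall x, W x -> dot n (gV x) (X x) = 0) ->
  (forall x i, W x -> (i < n)%nat -> Rabs (vsub (X x) (gV x) i) <= M) ->
  (forall x y i, W x -> W y -> (i < n)%nat ->
     Rabs (vsub (X y) (gV y) i - vsub (X x) (gV x) i) <= L * norm n (vsub y x)) ->
  forall p, W p -> V p <= c ->
    exists y, y 0 = p /\ is_sol n (fun x => vsub (X x) (gV x)) W (fun t => 0 <= t) y.
Proof.
  intros Hr HL HM HW Hc HV HX HFM HFL p Wp Vp.
  set (F := fun x => vsub (X x) (gV x)).
  destruct (lipschitz_field_extension n W F L M) as [G [GF [GM GL]]];
    [now exists p|assumption|assumption|assumption|].
  destruct (bounded_lipschitz_flow n G L M p HL HM GM GL) as [y [Hy0 [Hylip Hyd]]].
  assert (Pn := pos_INR n).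
  assert (PM : 0 <= INR n * M) by now apply Rmult_le_pos.
  assert (PB : 0 <= L * (INR n * M)) by now apply Rmult_le_pos.
  (* Within time [delta] the curve moves by at most [r / 2], the gap between the confined region and
     the edge of [W]. *)
  set (delta := r / (2 * (INR n * M + 1))).
  assert (Hdelta : 0 < delta) by (apply Rdiv_lt_0_compat; lra).
  assert (Hdelta' : INR n * M * delta <= r / 2).
  { replace (r / 2) with ((INR n * M + 1) * delta) by (unfold delta; field; lra).
    apply Rmult_le_compat_r; lra. }
  assert (Hadv : forall a t, 0 <= a -> a <= t <= a + delta -> W (y a) -> V (y a) <= c ->
    W (y t) /\ V (y t) <= c).
  { intros a t Ha Ht Wa Va.
    (* Staying in [W] comes from the speed bound alone; only then is the curve known to solve the
       original equation, so that [V] can be shown to decrease. *)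
    assert (Wst : forall s, a <= s <= t -> W (y s)).
    { intros s Hs. destruct (Hc (y a) Wa Va) as [z [Zz Hz]]. apply HW. exists z.
      split; [assumption|].
      assert (T := norm_vsub_triangle n (y s) (y a) z).
      assert (Q : norm n (vsub (y s) (y a)) <= INR n * (M * delta)).
      { apply norm_le_const. intros i Hi. unfold vsub.
        eapply Rle_trans; [apply Hylip; [lra|lra|assumption]|].
        apply Rmult_le_compat_l; [assumption|]. rewrite Rabs_pos_eq; lra. }
      lra. }
    split; [apply Wst; lra|].
    assert (Hsol : is_sol n F W (fun s => a <= s <= t) y).
    { apply (is_sol_of_quadratic_error n F G W _ y (L * (INR n * M))); auto.
      intros s u i Hs Hu Hi. apply Hyd; [lra|lra|assumption]. }
    assert (Q := is_sol_dissipation n X gV V W _ y a t 0 HV HX Hsol ltac:(lra)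
      ltac:(auto) ltac:(intros; apply dot_nonneg)).
    lra. }
  assert (Hk : forall k t, 0 <= t <= INR k * delta -> W (y t) /\ V (y t) <= c).
  { induction k as [|k IH]; intros t Ht.
    - simpl in Ht. replace t with 0 by lra. rewrite Hy0. auto.
    - rewrite S_INR in Ht. destruct (Rle_dec t (INR k * delta)) as [H|H]; [apply IH; lra|].
      assert (Q : 0 <= INR k * delta) by (apply Rmult_le_pos; [apply pos_INR|lra]).
      destruct (IH (INR k * delta) ltac:(lra)) as [Wk Vk].
      apply (Hadv (INR k * delta)); auto. lra. }
  exists y. split; [assumption|].
  apply (is_sol_of_quadratic_error n F G W _ y (L * (INR n * M))); auto.
  intros t Ht. destruct (INR_unbounded (t / delta)) as [k Hkt].
  apply (Hk k). split; [assumption|].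
  replace t with (t / delta * delta) by (field; lra). apply Rmult_le_compat_r; lra.
Qed.

(** Uniqueness identifies [y] and [Y] on the first [n] coordinates only, so [z] has to switch from
    one to the other at [T]. The field takes the same value along [z] and [Y] by its Lipschitz bound
    at distance 0. *)
Lemma is_sol_extend (n : nat) (F : vec -> vec) (W : vset) (L T : R) (y Y : R -> vec) :
  (forall u v i, W u -> W v -> (i < n)%nat -> Rabs (F v i - F u i) <= L * norm n (vsub v u)) ->
  is_sol n F W (fun t => 0 <= t < T) y -> is_sol n F W (fun t => 0 <= t) Y -> Y 0 = y 0 ->
  exists z, (forall t, 0 <= t < T -> z t = y t) /\ is_sol n F W (fun t => 0 <= t) z.
Proof.
  intros HF Hy HY H0.
  assert (E := is_sol_unique n F W L T y Y HF Hy
    (is_sol_weaken n F W _ _ Y (fun t (Ht : 0 <= t < T) => proj1 Ht) HY) (eq_sym H0)).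
  set (z := fun t => if Rlt_dec t T then y t else Y t).
  assert (Ez : forall t i, 0 <= t -> (i < n)%nat -> z t i = Y t i).
  { intros t i Ht Hi. unfold z. destruct (Rlt_dec t T); [apply E; auto|reflexivity]. }
  assert (Wz : forall t, 0 <= t -> W (z t)).
  { intros t Ht. unfold z. destruct (Rlt_dec t T); [apply Hy; auto|apply HY; auto]. }
  exists z. split.
  - intros t Ht. unfold z. destruct (Rlt_dec t T); [reflexivity|lra].
  - intros t Ht. split; [now apply Wz|]. intros eps Heps.
    destruct (proj2 (HY t Ht) eps Heps) as [d [Hd Hb]]. exists d. split; [assumption|].
    intros s Hs Hst. specialize (Hb s Hs Hst).
    rewrite (norm_ext n _ (vsub (vsub (Y s) (Y t)) (vscal (s - t) (F (Y t))))); [assumption|].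
    intros i Hi. unfold vsub, vscal. rewrite !Ez by assumption.
    assert (Q := HF (Y t) (z t) i (proj1 (HY t Ht)) (Wz t Ht) Hi).
    assert (Q0 : norm n (vsub (z t) (Y t)) = 0).
    { rewrite (norm_ext n _ (vsub (Y t) (Y t))); [apply norm_vsub_diag|].
      intros j Hj. unfold vsub. now rewrite Ez. }
    rewrite Q0, Rmult_0_r in Q. apply Rabs_le_between in Q.
    replace (F (z t) i) with (F (Y t) i) by lra. reflexivity.
Qed.

Lemma gradient_like_convergence (n : nat) (X gV : vec -> vec) (V : vec -> R) (W : vset)
  (C delta : R) (y : R -> vec) :
  0 < C -> 0 < delta ->
  (forall x, 0 <= V x) ->
  (forall x, W x -> is_gradient n V x (gV x)) ->
  (forall x, W x -> dot n (gV x) (X x) = 0) ->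
  (forall x, W x -> V x <= C * norm n (gV x)) ->
  is_sol n (fun x => vsub (X x) (gV x)) W (fun t => 0 <= t) y ->
  exists T, 0 <= T /\ forall t, T <= t -> V (y t) <= delta.
Proof.
  intros HC Hdelta Hpos HV HX HVC Hsol.
  assert (Hex : exists T, 0 <= T /\ V (y T) <= delta).
  { apply NNPP. intros Hno.
    assert (Hbig : forall t, 0 <= t -> delta < V (y t)).
    { intros t Ht. apply Rnot_le_lt. intros H. apply Hno. now exists t. }
    set (kap := (delta / C) * (delta / C)).
    assert (Hq : 0 < delta / C) by (apply Rdiv_lt_0_compat; lra).
    assert (Hkap : 0 < kap) by now apply Rmult_lt_0_compat.
    (* At rate [kap] the value would have dropped to [-1] or below by this time. *)
    set (T := (V (y 0) + 1) / kap).
    assert (HT : 0 <= T).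
    { apply Rlt_le, Rdiv_lt_0_compat; [assert (P := Hpos (y 0)); lra|assumption]. }
    assert (Q := is_sol_dissipation n X gV V W _ y 0 T kap HV HX Hsol HT ltac:(intros; lra)).
    assert (QT : kap * (T - 0) = V (y 0) + 1) by (unfold T; field; lra).
    rewrite QT in Q. assert (P := Hpos (y T)).
    enough (V (y T) <= V (y 0) - (V (y 0) + 1)) by lra.
    apply Q. intros t Ht. rewrite <- norm_sqr.
    assert (B := HVC (y t) (proj1 (Hsol t (proj1 Ht)))). assert (B' := Hbig t (proj1 Ht)).
    assert (delta / C <= norm n (gV (y t))).
    { apply (Rmult_le_reg_l C); [assumption|].
      replace (C * (delta / C)) with delta by (field; lra). lra. }
    apply Rmult_le_compat; lra. }
  destruct Hex as [T [HT HVT]]. exists T. split; [assumption|]. intros t Ht.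
  assert (Q := is_sol_dissipation n X gV V W _ y T t 0 HV HX Hsol Ht
    ltac:(intros; lra) ltac:(intros; apply dot_nonneg)). lra.
Qed.

(** Invariance and convergence of global trajectories alone would say nothing about solutions known
    only for finite time; the existence and extension clauses close that gap. As [V] is nonnegative,
    [V <= c] describes the preimage of [[0, c]]. *)
Theorem theorem3 (n m : nat) (U : vset) (X : vec -> vec) (f : vec -> vec)
  (Df : vec -> mat) (x0 : vec) (K : mat) (gV : vec -> vec) :
  is_open n U ->
  C1_on n n U X ->
  (* f is C^2 on U, with derivative Df *)
  (forall x, U x -> has_deriv_at n m f x (Df x)) ->
  (forall i j, (i < m)%nat -> (j < n)%nat -> C1_on n 1 U (fun x => fun _ => Df x i j)) ->
  U x0 ->
  symmetric m K -> posdef m K ->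
  (* gV is the gradient of V *)
  (forall x, U x -> is_gradient n (Lyap m K f x0) x (gV x)) ->
  (forall x, U x -> dot n (gV x) (X x) = 0) ->
  is_compact n (fun x => U x /\ Lyap m K f x0 x = 0) ->
  (forall x, U x -> Lyap m K f x0 x = 0 -> onto n m (Df x)) ->
  exists (c : R) (W : vset),
    0 < c /\ is_open n W /\ (forall x, W x -> U x) /\
    (forall x, U x -> Lyap m K f x0 x = 0 -> W x) /\
    let S := fun x => W x /\ Lyap m K f x0 x <= c in
    let F := fun x => vsub (X x) (gV x) in
    (* trajectories from S exist for all t >= 0 *)
    (forall p, S p -> exists y, y 0 = p /\ is_sol n F W (fun t => 0 <= t) y) /\
    (* every trajectory from S extends to all t >= 0 *)
    (forall (T : R) (y : R -> vec), 0 < T -> S (y 0) ->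
       is_sol n F W (fun t => 0 <= t < T) y ->
       exists z, (forall t, 0 <= t < T -> z t = y t) /\
                 is_sol n F W (fun t => 0 <= t) z) /\
    (* every (global) trajectory from S stays in S and converges to V^-1(0) *)
    (forall y : R -> vec, S (y 0) -> is_sol n F W (fun t => 0 <= t) y ->
       (forall t, 0 <= t -> S (y t)) /\
       conv_to_set n (fun x => U x /\ Lyap m K f x0 x = 0) y).
Proof.
  intros HU HX Hf HDf _ HK HKpos HgV Horth HZ Honto.
  set (V := Lyap m K f x0) in *. set (Z := fun x => U x /\ V x = 0) in *.
  set (F := fun x => vsub (X x) (gV x)).
  assert (Hpos : forall x, 0 <= V x) by (intros; now apply Lyap_nonneg).
  assert (LDf : forall z i j, U z -> (i < m)%nat -> (j < n)%nat -> loc_lip n (fun x => Df x i j) z).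
  { intros z i j Uz Hi Hj.
    exact (C1_on_loc_lip n 1 U (fun x _ => Df x i j) z 0 HU (HDf i j Hi Hj) Uz Nat.lt_0_1). }
  assert (Lf : forall z i, U z -> (i < m)%nat -> loc_lip n (fun x => f x i) z).
  { intros z i Uz Hi. apply (C1_on_loc_lip n m U); auto. exists Df. split; [assumption|].
    intros k j Hk Hj x Ux eps Heps.
    destruct (loc_lip_near n _ x (eps / 2) (LDf x k j Ux Hk Hj) ltac:(lra)) as [d [Hd H]].
    exists d. split; [assumption|]. intros y _ Hy. specialize (H y Hy). lra. }
  assert (Hder : forall z, U z -> near n z (fun x => has_deriv_at n m f x (Df x) /\
      is_gradient n V x (gV x))).
  { intros z Uz. destruct (HU z Uz) as [d [Hd Hb]]. exists d. auto. }
  assert (LF : forall z i, U z -> (i < n)%nat -> loc_lip n (fun x => F x i) z).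
  { intros z i Uz Hi.
    apply (loc_lip_congr n (fun x => X x i + -1 * gV x i)).
    - exists 1. split; [lra|]. intros x _. unfold F, vsub. ring.
    - apply loc_lip_plus; [now apply (C1_on_loc_lip n n U)|].
      apply loc_lip_mult; [apply loc_lip_const|].
      apply (loc_lip_Lyap_gradient n m K f Df x0); auto. }
  assert (HVc : continuous_on n U V).
  { intros x Ux eps Heps.
    destruct (loc_lip_near n V x (eps / 2)) as [d [Hd H]]; [|lra|].
    - apply loc_lip_Lyap. auto.
    - exists d. split; [assumption|]. intros y _ Hy. specialize (H y Hy). lra. }
  (* [Q1] keeps limits of points of [W] inside [U], [Q2] and [Q3] feed the extension of the field,
     [Q4] provides cluster points, and [Q5] forces [V] to decrease to 0. *)
  set (Q1 := fun x C => 0 < C /\ forall y, norm n (vsub y x) < / C -> U y).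
  set (Q2 := fun x C => forall i, (i < n)%nat -> 0 < C /\ forall y, norm n (vsub y x) < / C ->
     Rabs (F y i - F x i) <= C * norm n (vsub y x)).
  set (Q3 := fun x C => forall i, (i < n)%nat -> Rabs (F x i) <= C).
  set (Q4 := fun x C => forall i : nat, (i < n)%nat -> Rabs (x i) <= C).
  set (Q5 := fun x C => V x <= C * norm n (gV x)).
  assert (M1 : monotone_bound Q1) by (apply monotone_bound_ball; intros y x C C' _ H; exact H).
  assert (M2i : forall i, monotone_bound (fun x C => 0 < C /\ forall y,
     norm n (vsub y x) < / C -> Rabs (F y i - F x i) <= C * norm n (vsub y x))).
  { intros i.
    apply (monotone_bound_ball n (fun y x C => Rabs (F y i - F x i) <= C * norm n (vsub y x))).
    intros y x C C' HC H. eapply Rle_trans; [exact H|].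
    apply Rmult_le_compat_r; [apply norm_nonneg|assumption]. }
  assert (M2 : monotone_bound Q2) by now apply monotone_bound_forall_lt.
  assert (M3 : monotone_bound Q3)
    by (apply monotone_bound_forall_lt; intros i x C C' HC H; lra).
  assert (M4 : monotone_bound Q4)
    by (apply monotone_bound_forall_lt; intros i x C C' HC H; lra).
  assert (M5 : monotone_bound Q5).
  { intros x C C' HC H. eapply Rle_trans; [exact H|].
    apply Rmult_le_compat_r; [apply norm_nonneg|assumption]. }
  assert (M45 := monotone_bound_and _ _ M4 M5).
  assert (M35 := monotone_bound_and _ _ M3 M45).
  assert (M25 := monotone_bound_and _ _ M2 M35).
  destruct (compact_uniform n Z
    (fun x C => Q1 x C /\ Q2 x C /\ Q3 x C /\ Q4 x C /\ Q5 x C) HZ) as [r [C [Hr [HC HQ]]]].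
  { now apply (monotone_bound_and Q1). }
  { intros z [Uz Vz].
    apply (near_bound_and n z Q1); [assumption|assumption| |
      apply (near_bound_and n z Q2); [assumption|assumption| |
        apply (near_bound_and n z Q3); [assumption|assumption| |
          apply (near_bound_and n z Q4); [assumption|assumption| |]]]].
    - destruct (HU z Uz) as [d [Hd Hb]].
      exists (/ (d / 2)), (d / 2). split; [lra|]. intros x Hx.
      split; [apply Rinv_0_lt_compat; lra|]. intros y Hy. rewrite Rinv_inv in Hy.
      apply Hb. assert (T := norm_vsub_triangle n y x z). lra.
    - apply near_bound_forall_lt; [assumption|].
      intros i Hi. apply (loc_lip_ball n (fun x => F x i)). now apply LF.
    - apply near_bound_forall_lt; [intros i x C C' HC H; lra|].
      intros i Hi. exists (Rabs (F z i) + 1). apply (loc_lip_bounded n (fun x => F x i)). now apply LF.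
    - apply near_bound_forall_lt; [intros i x C C' HC H; lra|].
      intros i Hi. exists (Rabs (z i) + 1). apply (loc_lip_bounded n (fun x => x i)).
      now apply loc_lip_coord.
    - destruct (Lyap_le_gradient n m K f Df x0 gV z) as [C [_ HC]]; auto.
      now exists C. }
  set (W := fun x => exists z, Z z /\ norm n (vsub x z) < r).
  assert (HWQ : forall x, W x -> Q1 x C /\ Q2 x C /\ Q3 x C /\ Q4 x C /\ Q5 x C).
  { intros x [z [Zz Hx]]. now apply (HQ z). }
  assert (HinvC : 0 < / C) by now apply Rinv_0_lt_compat.
  assert (WU : forall x, W x -> U x).
  { intros x Wx. apply (proj1 (HWQ x Wx)). now rewrite norm_vsub_diag. }
  assert (Hsmall := small_value_near_zero_set n U W V C (/ C) HVc Hpos HinvC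
    (fun x i Wx => proj1 (proj2 (proj2 (proj2 (HWQ x Wx)))) i)
    (fun x y Wx => proj2 (proj1 (HWQ x Wx)) y)).
  set (L := C + 2 * C * C).
  assert (HL : 0 <= L) by (unfold L; assert (0 < C * C) by (apply Rmult_lt_0_compat; lra); lra).
  assert (HFM : forall x i, W x -> (i < n)%nat -> Rabs (F x i) <= C)
    by (intros x i Wx Hi; exact (proj1 (proj2 (proj2 (HWQ x Wx))) i Hi)).
  assert (HFL : forall x y i, W x -> W y -> (i < n)%nat ->
     Rabs (F y i - F x i) <= L * norm n (vsub y x)).
  { intros x y i Wx Wy Hi. apply (lipschitz_of_local n W (fun x => F x i) C); auto.
    intros u v Wu. exact (proj2 (proj1 (proj2 (HWQ u Wu)) i Hi) v). }
  assert (WV : forall x, W x -> is_gradient n V x (gV x)) by auto.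
  assert (WX : forall x, W x -> dot n (gV x) (X x) = 0) by auto.
  (* This level leaves the gap [r / 2] that [sublevel_flow_exists] asks for. *)
  destruct (Hsmall (r / 2) ltac:(lra)) as [c [Hc Hcr]].
  assert (Hflow : forall p, W p -> V p <= c ->
     exists y, y 0 = p /\ is_sol n F W (fun t => 0 <= t) y).
  { apply (sublevel_flow_exists n X gV V Z W r c L C); auto; [lra|]. intros x; reflexivity. }
  exists c, W. split; [assumption|]. split; [|split; [assumption|split]].
  - intros x [z [Zz Hx]]. exists (r - norm n (vsub x z)). split; [lra|].
    intros y Hy. exists z. split; [assumption|].
    assert (T := norm_vsub_triangle n y x z). lra.
  - intros x Ux Vx. exists x. split; [split; assumption|]. now rewrite norm_vsub_diag.
  - split; [|split].
    + intros p [Wp Vp]. now apply Hflow.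
    + intros T y _ [Wy Vy] Hsol. destruct (Hflow (y 0) Wy Vy) as [Y [HY0 HY]].
      now apply (is_sol_extend n F W L T y Y).
    + intros y [Wy Vy] Hsol. split.
      * intros t Ht. split; [now apply Hsol|].
        assert (Q := is_sol_dissipation n X gV V W _ y 0 t 0 WV WX Hsol Ht
          ltac:(intros; lra) ltac:(intros; apply dot_nonneg)). fold V in Vy |- *. lra.
      (* Convergence to the zero set reduces to [V] falling below the level [d] that forces distance
         less than [eps]. *)
      * intros eps Heps. destruct (Hsmall eps Heps) as [d [Hd Hds]].
        destruct (gradient_like_convergence n X gV V W C d y) as [T [HT HTd]]; auto.
        { intros x Wx. now apply HWQ. }
        exists T. intros t Ht. apply Hds; [|now apply HTd]. apply Hsol. lra.
Qed.
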